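(* Let $n\ge 1$, let $\mathcal{C}_i \in \mathbb{C}^{I_1 \times \cdots \times I_N \times I_1 \times \cdots \times I_N}$, $1 \leq i \leq n$, be positive Hermitian tensors with Hermitian rank $r$, and let $\|\cdot\|_{(k)}$ be a Ky Fan $k$-norm, $k\in\{1,\dots,r\}$. Put $\iota=\sqrt{-1}$ and $\beta_0(t) = \frac{\pi}{2 (\cosh (\pi t) + 1)}$. (1) For any continuous function $f:(0, \infty) \rightarrow [0, \infty)$ such that $x \mapsto \log f(e^x)$ is convex on $\mathbb{R}$, $$\left\Vert f \left( \exp \left( \sum_{i=1}^n \log \mathcal{C}_i\right) \right) \right\Vert_{(k)} \leq \exp \int_{- \infty}^{\infty} \log \left\Vert f \left( \left\vert \prod_{i=1}^{n} \mathcal{C}_i^{1 + \iota t} \right\vert\right)\right\Vert_{(k)} \beta_0(t)\, dt .$$ (2) For any continuous function $g:(0, \infty) \rightarrow [0, \infty)$ such that $x \mapsto g (e^x)$ is convex on $\mathbb{R}$, $$\left\Vert g \left( \exp \left( \sum_{i=1}^n \log \mathcal{C}_i\right) \right) \right\Vert_{(k)} \leq \int_{- \infty}^{\infty} \left\Vert g \left( \left\vert \prod_{i=1}^{n} \mathcal{C}_i^{1 + \iota t} \right\vert\right)\right\Vert_{(k)} \beta_0(t)\, dt .$$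
   Context: Square tensors in $\mathbb{C}^{I_1 \times \cdots \times I_N \times I_1 \times \cdots \times I_N}$ are multiplied by the Einstein product $(\mathcal{X}\star_N\mathcal{Y})_{i_1,\dots,i_N,k_1,\dots,k_N}=\sum_{j_1,\dots,j_N}x_{i_1,\dots,i_N,j_1,\dots,j_N}\,y_{j_1,\dots,j_N,k_1,\dots,k_N}$; juxtaposition and $\prod_{i=1}^n$ (in the order $i=1,\dots,n$) denote this product. The conjugate transpose is $(\mathcal{X}^H)_{j_1,\dots,j_N,i_1,\dots,i_N}=\overline{x_{i_1,\dots,i_N,j_1,\dots,j_N}}$, and $\mathcal{X}$ is Hermitian if $\mathcal{X}^H=\mathcal{X}$. A Hermitian tensor has a decomposition $\mathcal{H}=\sum_{i=1}^r\lambda_i\,\mathcal{U}_i\otimes\mathcal{U}_i^H$ with $\lambda_i\in\mathbb{R}$, $\langle\mathcal{U}_i,\mathcal{U}_i\rangle=1$, $\langle\mathcal{U}_i,\mathcal{U}_j\rangle=0$ for $i\ne j$; the $\lambda_i$ are its Hermitian eigenvalues and the minimal such $r$ its Hermitian rank. It is positive if all Hermitian eigenvalues are positive. Functions of Hermitian tensors (including $\log$, $\exp$, complex powers $\mathcal{C}^z=\exp(z\log\mathcal{C})$) are defined by functional calculus on this decomposition. $|\mathcal{X}|=\sqrt{\mathcal{X}^H\star_N\mathcal{X}}$. With eigenvalues listed in decreasing order $\lambda_1\ge\lambda_2\ge\cdots$, the Ky Fan $k$-norm is $\|\mathcal{X}\|_{(k)}=\sum_{i=1}^k\lambda_i(|\mathcal{X}|)$.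 *)

(* Defs.v *)
From HB Require Import structures.
From mathcomp Require Import all_boot all_order all_algebra.
From mathcomp Require Import all_classical all_reals all_analysis.
From mathcomp Require Export complex.
Set Implicit Arguments.
Unset Strict Implicit.
Unset Printing Implicit Defensive.
Import Order.TTheory GRing.Theory Num.Theory.
Import numFieldNormedType.Exports.
Local Open Scope classical_set_scope.
Local Open Scope ring_scope.
Local Open Scope complex_scope.

(* Multi-indices are 0-based: j <= N-1 and the j-th entry ranges over
   {0, .., I_j - 1}. *)
Definition mindex (N : nat) (I : 'I_N -> nat) : finType :=
  {dffun forall j : 'I_N, 'I_(I j)}.

Definition vec (R : realType) (N : nat) (I : 'I_N -> nat) :=
  {ffun mindex I -> R[i]}.

Definition tensor (R : realType) (N : nat) (I : 'I_N -> nat) :=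
  {ffun mindex I * mindex I -> R[i]}.

Section Tensor.
Variables (R : realType) (N : nat) (I : 'I_N -> nat).
Implicit Types (X Y : tensor R I) (U V : vec R I).

Definition tmul X Y : tensor R I :=
  [ffun p => \sum_(j : mindex I) X (p.1, j) * Y (j, p.2)].

Definition tone : tensor R I := [ffun p => (p.1 == p.2)%:R].

Definition tadj X : tensor R I := [ffun p => (X (p.2, p.1))^*].

Definition hermitian X := tadj X = X.

Definition tprod (n : nat) (A : 'I_n -> tensor R I) : tensor R I :=
  \big[tmul/tone]_(i < n) A i.

Definition inner U V : R[i] := \sum_(j : mindex I) (U j)^* * V j.

(* \sum_s c_s (U_s \otimes U_s^H) *)
Definition outer_sum (r : nat) (c : 'I_r -> R[i]) (U : 'I_r -> vec R I) :
    tensor R I :=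
  [ffun p => \sum_(s < r) c s * (U s p.1 * (U s p.2)^*)].

(* The coefficients are allowed to vanish. *)
Definition herm_decomp X (r : nat) (l : 'I_r -> R) (U : 'I_r -> vec R I) :=
  X = outer_sum (fun s => (l s)%:C) U /\
  forall s t, inner (U s) (U t) = (s == t)%:R.

Definition herm_eigenvalue X (a : R) :=
  exists (r : nat) (l : 'I_r -> R) (U : 'I_r -> vec R I),
    herm_decomp X l U /\ exists s, l s = a.

Definition has_herm_decomp X (r : nat) :=
  exists (l : 'I_r -> R) (U : 'I_r -> vec R I), herm_decomp X l U.

Definition herm_rank X (r : nat) :=
  has_herm_decomp X r /\ forall r', has_herm_decomp X r' -> (r <= r')%N.

Definition positive_herm X :=
  hermitian X /\ forall a, herm_eigenvalue X a -> 0 < a.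

(* A chosen decomposition of full length I_1 * .. * I_N, in which the zero
   eigenvalues are listed with their multiplicity, so that f (X) below accounts
   for f 0 on the kernel of X (e.g. exp 0 is the identity tensor). For a
   Hermitian X, neither [tfun] nor [eigvals] depends on the choice; for a
   non-Hermitian X they are junk. *)
Definition full_decomp X :
    {ffun 'I_#|mindex I| -> R} * {ffun 'I_#|mindex I| -> vec R I} :=
  xget ([ffun=> 0], [ffun=> [ffun=> 0]])
    [set d : {ffun 'I_#|mindex I| -> R} * {ffun 'I_#|mindex I| -> vec R I} |
      herm_decomp X d.1 d.2].

Definition tfun (f : R -> R[i]) X : tensor R I :=
  outer_sum (fun s => f ((full_decomp X).1 s)) (full_decomp X).2.

Definition tfunr (f : R -> R) X : tensor R I := tfun (fun x => (f x)%:C) X.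

Definition eigvals X : seq R :=
  sort (fun a b => b <= a) [seq (full_decomp X).1 s | s : 'I_#|mindex I|].

Definition texp X : tensor R I := tfunr (@expR R) X.

Definition tlog X : tensor R I := tfunr (@ln R) X.

Definition cexp (z : R[i]) : R[i] :=
  (expR (complex.Re z))%:C * (cos (complex.Im z) +i* sin (complex.Im z)).

Definition tpow X (z : R[i]) : tensor R I :=
  tfun (fun x => cexp (z * (ln x)%:C)) X.

Definition tabs X : tensor R I := tfunr (@Num.sqrt R) (tmul (tadj X) X).

Definition kyfan (k : nat) X : R := \sum_(j < k) (eigvals (tabs X))`_j.

End Tensor.

Definition cosh (R : realType) (x : R) : R := (expR x + expR (- x)) / 2.

Definition beta0 (R : realType) (t : R) : R := pi / (2 * (cosh (pi * t) + 1)).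

(* Convexity for functions that may take the value -oo, such as the logarithm
   of a function with zeros. *)
Definition econvex (R : realType) (h : R -> \bar R) :=
  forall t x y : R, 0 <= t <= 1 ->
    (h (t * x + (1 - t) * y)%R <= t%:E * h x + (1 - t)%R%:E * h y)%E.

(* Main.v *)
Require Import Defs.
From mathcomp Require Import all_boot all_order all_algebra fingroup perm.
From mathcomp Require Import all_classical all_reals all_analysis.
From mathcomp Require Import measurable_realfun.
From mathcomp Require spectral.
From mathcomp Require Import ring lra.
Set Implicit Arguments.
Unset Strict Implicit.
Unset Printing Implicit Defensive.
Import Order.TTheory GRing.Theory Num.Theory.
Import numFieldNormedType.Exports.
Local Open Scope classical_set_scope.
Local Open Scope ring_scope.
Local Open Scope complex_scope.

(* Let [H = \sum_i log C_i], with eigenvalues [a_0 >= a_1 >= ..], and let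
   [G(z) = C_1^z ... C_n^z]. If the columns of [V] are orthonormal eigenvectors of
   [H] for [a_0, .., a_m], then [h(z) = det (V^* G(z) V)] is an exponential sum with
   [h(0) = 1] and [h'(0) = a_0 + .. + a_m]. By Cauchy-Binet [|h(z)|] is at most the
   product of the [m+1] largest singular values of [G(z)], which is [1] on the
   imaginary axis, where [G] is unitary. As [log |h|] is subharmonic on the strip
   [0 <= Re z <= 1] and maximal at [0] on the left boundary, comparing normal
   derivatives at [0] with its harmonic majorant gives
   [h'(0) <= \int log |h(1 + i t)| beta0(t) dt]. Hence the vector [a] is majorized by the
   [beta0]-average of the vectors of logarithms of singular values of [G(1 + i t)], with
   equality of the total sums because of the determinant. Both inequalities follow
   by integrating a tangent (supporting) inequality at [a] for the convex function
   at hand and summing by parts. No Lie-Trotter limit is needed, and working with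
   [log (|h|^2 + k) / 2] instead of [log |h|] avoids the zeros of [h]. *)

(** * Derivatives and the maximum principle *)

(** The weight [beta0] is forced: seen from the boundary point 0, the part of the line [Re z = 1]
    below height [a] has harmonic measure with inner normal derivative [(1 + tanh (pi a / 2)) / 2],
    and [beta0] is the derivative of this in [a]. The harmonic majorant is not built as a Poisson
    integral but approximated by finite combinations of explicit harmonic measures, so that
    comparing derivatives yields a Riemann-Stieltjes sum. These combinations jump on the right side
    of the strip, so the maximum principle is applied on rectangles stopping short of it, with a
    quadratic penalty for large heights. The integrands of the theorem involve chosen spectral
    decompositions, and their measurability is never established: they are only bounded below
    pointwise by continuous functions. Hence the summation by parts precedes the integration, on the
    level of subharmonic functions, which are stable under nonnegative combinations. The
    regularization by [k] costs a factor [1 / (1 + k)] in the derivative and an additive error; the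
    latter is uniform in [t] because [|det G(1 + i t)|] does not depend on [t]. *)

Section Derivatives.
Context {R : realType}.
Implicit Types (f g : R -> R) (x y a b : R).

Lemma der_cst a x : is_derive x 1 (fun=> a) 0.
Proof. exact: is_derive_cst. Qed.

Lemma der_id x : is_derive x 1 (fun z : R => z) 1.
Proof. exact: is_derive_id. Qed.

Lemma derD f g x a b : is_derive x 1 f a -> is_derive x 1 g b ->
  is_derive x 1 (fun z => f z + g z) (a + b).
Proof. by move=> *; exact: is_deriveD. Qed.

Lemma derN f x a : is_derive x 1 f a -> is_derive x 1 (fun z => - f z) (- a).
Proof. by move=> *; exact: is_deriveN. Qed.

Lemma derB f g x a b : is_derive x 1 f a -> is_derive x 1 g b ->
  is_derive x 1 (fun z => f z - g z) (a - b).
Proof. by move=> *; exact: is_deriveB. Qed.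

Lemma derM f g x a b : is_derive x 1 f a -> is_derive x 1 g b ->
  is_derive x 1 (fun z => f z * g z) (a * g x + f x * b).
Proof.
move=> fa gb; apply: (is_derive_eq (is_deriveM fa gb)).
by rewrite addrC /GRing.scale /= [g x * a]mulrC.
Qed.

Lemma derZ f x a k : is_derive x 1 f a -> is_derive x 1 (fun z => k * f z) (k * a).
Proof.
move=> fa; apply: (is_derive_eq (derM (der_cst k x) fa)).
by rewrite mul0r add0r.
Qed.

Lemma derV f x a : is_derive x 1 f a -> f x != 0 ->
  is_derive x 1 (fun z => (f z)^-1) (- a / f x ^+ 2).
Proof.
move=> fa f0; apply: (is_derive_eq (is_deriveV f0 fa)).
by rewrite /GRing.scale /= mulNr mulrC mulNr.
Qed.

Lemma der_comp f g x a b : is_derive (g x) 1 f a -> is_derive x 1 g b ->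
  is_derive x 1 (fun z => f (g z)) (a * b).
Proof. by move=> *; exact: is_derive1_comp. Qed.

Lemma der_sum n (F : 'I_n -> R -> R) (dF : 'I_n -> R) x :
  (forall i, is_derive x 1 (F i) (dF i)) ->
  is_derive x 1 (fun z => \sum_(i < n) F i z) (\sum_(i < n) dF i).
Proof.
move=> /is_derive_sum; rewrite (_ : \sum_(i < n) F i = fun z => \sum_(i < n) F i z)//.
by apply/funext => z; rewrite fct_sumE.
Qed.

Lemma der_continuous f x a : is_derive x 1 f a -> {for x, continuous f}.
Proof. by move=> [+ _] => /derivable1_diffP/differentiable_continuous. Qed.

Lemma der_pos_right f x s : is_derive x 1 f s -> 0 < s ->
  exists2 e, 0 < e & forall y, x < y -> y < x + e -> f x < f y.
Proof.
move=> [df ds] s0.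
have : h^-1 *: (f (h *: 1 + x) - f x) @[h --> 0^'] --> s.
  by rewrite -ds; exact: df.
move=> /cvgr_gt /(_ _ s0) [e /= e0 He]; exists e => // y xy ye.
have := He (y - x); rewrite /= /ball_ /= sub0r normrN gtr0_norm ?subr_gt0//.
rewrite ltrBlDl => /(_ ye); rewrite subr_eq0 gt_eqF// => /(_ isT).
rewrite /GRing.scale /= mulr1 subrK pmulr_rgt0 ?invr_gt0 ?subr_gt0//.
Qed.

(** Were [s] positive, [f'] would vanish at [x] and be positive just to the right of it, so [f]
    would exceed its maximum there. *)
Lemma second_derivative_at_max f f' a b x s : a < x < b ->
  (forall y, a < y < b -> is_derive y 1 f (f' y)) -> is_derive x 1 f' s ->
  (forall y, a < y < b -> f y <= f x) -> s <= 0.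
Proof.
move=> /andP[ax xb] df df' fmax; rewrite leNgt; apply/negP => s0.
have xab : x \in `]a, b[%R by rewrite in_itv/= ax xb.
have ab : a <= b by apply/ltW/(lt_trans ax).
have f'x : f' x = 0.
  have [||_ <-] := @derive1_at_max _ f _ _ _ ab _ xab.
  - by move=> t; rewrite in_itv => /df [].
  - by move=> t; rewrite in_itv => /fmax.
  - by apply/esym/derive_val/df; rewrite ax.
have [e e0 He] := der_pos_right df' s0.
pose y := Num.min ((x + b) / 2) (x + e / 2).
have xy : x < y by rewrite lt_min; apply/andP; split; lra.
have yb : y < b.
  by apply: le_lt_trans (_ : (x + b) / 2 < b); [rewrite ge_min lexx|lra].
have ye : y < x + e.
  by apply: le_lt_trans (_ : x + e / 2 < _); [rewrite ge_min lexx orbT|lra].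
have [||c] := @MVT _ f f' x y xy.
- move=> t; rewrite in_itv /= => /andP[xt ty]; apply: df.
  by rewrite (lt_trans ax xt) (lt_trans ty yb).
- apply: derivable_within_continuous => t; rewrite in_itv /= => /andP[xt ty].
  by have [|//] := df t; rewrite (lt_le_trans ax xt) (le_lt_trans ty yb).
rewrite in_itv /= => /andP[xc cy] fyx.
have : 0 < f y - f x.
  rewrite fyx mulr_gt0 ?subr_gt0// -f'x He// (lt_trans cy ye)//.
have := fmax y; rewrite (lt_trans ax xy) yb => /(_ isT); lra.
Qed.

End Derivatives.

Section MaximumPrinciple.
Context {R : realType}.

(** At an interior maximum both pure second derivatives are nonpositive, against the strict sign of
    their sum. Strictness is supplied later by a penalty with negative Laplacian. *)
Lemma strict_subharmonic_max (w wx wy wxx wyy : R -> R -> R) (a b c d K : R) :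
  a <= b -> c <= d ->
  {within `[a, b] `*` `[c, d], continuous (fun p : R * R => w p.1 p.2)} ->
  (forall x y, a < x < b -> c < y < d ->
     [/\ is_derive x 1 (w ^~ y) (wx x y), is_derive x 1 (wx ^~ y) (wxx x y),
         is_derive y 1 (w x) (wy x y), is_derive y 1 (wy x) (wyy x y) &
         0 < wxx x y + wyy x y]) ->
  (forall y, c <= y <= d -> w a y <= K) -> (forall y, c <= y <= d -> w b y <= K) ->
  (forall x, a <= x <= b -> w x c <= K) -> (forall x, a <= x <= b -> w x d <= K) ->
  forall x y, a <= x <= b -> c <= y <= d -> w x y <= K.
Proof.
move=> ab cd cw dw wa wb wc wd x y xab ycd.
have [|| [x0 y0] /set_mem /= [+ +] max0] :=
    @compact_EVT_max _ R (fun p : R * R => w p.1 p.2) (`[a, b] `*` `[c, d]) _ _ cw.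
- by exists (a, c); split; rewrite /= in_itv/= lexx.
- by apply: compact_setX; exact: segment_compact.
rewrite !in_itv /= => x0ab y0cd.
have {}max0 x' y' : a <= x' <= b -> c <= y' <= d -> w x' y' <= w x0 y0.
  by move=> xx yy; apply: (max0 (x', y')); rewrite inE; split; rewrite /= in_itv.
apply: (le_trans (max0 _ _ xab ycd)).
have [<-|ax] := eqVneq a x0; first exact: wa.
have [->|bx] := eqVneq x0 b; first exact: wb.
have [<-|cy] := eqVneq c y0; first exact: wc.
have [->|dy] := eqVneq y0 d; first exact: wd.
have x0o : a < x0 < b by rewrite !lt_neqAle ax bx /=.
have y0o : c < y0 < d by rewrite !lt_neqAle cy dy /=.
have [d1 d2 d3 d4] := dw _ _ x0o y0o.
have le_oo p q z : p < z < q -> p <= z <= q.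
  by move=> /andP[*]; rewrite !ltW.
suff : wxx x0 y0 <= 0 /\ wyy x0 y0 <= 0 by case; lra.
split.
- apply: (@second_derivative_at_max _ (w ^~ y0) (wx ^~ y0) a b x0) => // z zab.
    by have [] := dw z y0 zab y0o.
  by apply: max0 => //; exact: le_oo.
- apply: (@second_derivative_at_max _ (w x0) (wy x0) c d y0) => // z zcd.
    by have [] := dw x0 z x0o zcd.
  by apply: max0 => //; exact: le_oo.
Qed.

End MaximumPrinciple.

(** * Harmonic measure of the strip *)

Section Tanh.
Context {R : realType}.
Implicit Types s t : R.

Definition tanh s := (expR s - expR (- s)) / (expR s + expR (- s)).

Let den_gt0 s : 0 < expR s + expR (- s).
Proof. by rewrite addr_gt0 ?expR_gt0. Qed.

Lemma der_tanh s : is_derive s 1 tanh (1 - tanh s ^+ 2).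
Proof.
have d1 : is_derive s 1 (fun z => expR (- z)) (expR (- s) * - 1).
  by apply: der_comp; apply: derN; exact: der_id.
have d2 := derM (derB (is_derive_expR s) d1)
  (derV (derD (is_derive_expR s) d1) (lt0r_neq0 (den_gt0 s))).
apply: (is_derive_eq d2); rewrite /tanh.
by field; exact: lt0r_neq0 (den_gt0 s).
Qed.

Lemma tanhN s : tanh (- s) = - tanh s.
Proof. by rewrite /tanh opprK [X in _ / X]addrC -mulNr opprB. Qed.

Lemma tanh_lt1 s : tanh s < 1.
Proof.
rewrite /tanh ltr_pdivrMr ?den_gt0// mul1r ltrD2l.
by have := expR_gt0 (- s); lra.
Qed.

Lemma tanh_gtN1 s : -1 < tanh s.
Proof. by rewrite ltrNl -tanhN tanh_lt1. Qed.

Lemma tanh_mono s t : s <= t -> tanh s <= tanh t.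
Proof.
move=> st; rewrite /tanh ler_pdivrMr ?den_gt0// mulrAC ler_pdivlMr ?den_gt0//.
have := ler_expR s t; have := ler_expR (- t) (- s); rewrite lerN2 st.
by have := expR_gt0 s; have := expR_gt0 (- t); nra.
Qed.

Lemma tanh_gt0 s : 0 < s -> 0 < tanh s.
Proof.
move=> s0; rewrite /tanh divr_gt0 ?den_gt0// subr_gt0 ltr_expR; lra.
Qed.

Lemma tanh_near1 (e : R) : 0 < e -> exists2 s, 0 < s & 1 - e <= tanh s.
Proof.
move=> e0; exists (Num.max 1 e^-1); first by rewrite lt_max ltr01.
set s := Num.max _ _; have s0 : 0 < s by rewrite lt_max ltr01.
rewrite /tanh ler_pdivlMr ?den_gt0//.
have h1 : 1 + s <= expR s by exact: expR_ge1Dx.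
have h2 : expR (- s) * expR s = 1 by rewrite -expRD addNr expR0.
have h3 : 1 <= e * s by rewrite -ler_pdivrMl// mulr1 le_max lexx orbT.
have h4 : expR (- s) <= 1 by rewrite -expR0 ler_expR; lra.
have := expR_gt0 (- s); have : 1 <= s by rewrite le_max lexx.
move=> s1 E0; have : 2 <= e * expR s + e * s by nra.
nra.
Qed.

End Tanh.

Section Partials.
Context {R : realType}.
Implicit Types (w v : R -> R -> R) (x y : R).

Definition partials (w wx wxx wy wyy : R -> R -> R) (x y : R) :=
  [/\ is_derive x 1 (w ^~ y) (wx x y), is_derive x 1 (wx ^~ y) (wxx x y),
      is_derive y 1 (w x) (wy x y) & is_derive y 1 (wy x) (wyy x y)].

Lemma partialsB w wx wxx wy wyy v vx vxx vy vyy x y :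
  partials w wx wxx wy wyy x y -> partials v vx vxx vy vyy x y ->
  partials (fun x y => w x y - v x y) (fun x y => wx x y - vx x y)
    (fun x y => wxx x y - vxx x y) (fun x y => wy x y - vy x y)
    (fun x y => wyy x y - vyy x y) x y.
Proof. by move=> [? ? ? ?] [? ? ? ?]; split; exact: derB. Qed.

Lemma partialsZ k w wx wxx wy wyy x y :
  partials w wx wxx wy wyy x y ->
  partials (fun x y => k * w x y) (fun x y => k * wx x y)
    (fun x y => k * wxx x y) (fun x y => k * wy x y)
    (fun x y => k * wyy x y) x y.
Proof. by move=> [? ? ? ?]; split; exact: derZ. Qed.

Lemma partials_sum n (w wx wxx wy wyy : 'I_n -> R -> R -> R) x y :
  (forall i, partials (w i) (wx i) (wxx i) (wy i) (wyy i) x y) ->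
  partials (fun x y => \sum_(i < n) w i x y) (fun x y => \sum_(i < n) wx i x y)
    (fun x y => \sum_(i < n) wxx i x y) (fun x y => \sum_(i < n) wy i x y)
    (fun x y => \sum_(i < n) wyy i x y) x y.
Proof. by move=> H; split; apply: der_sum => i; have [] := H i. Qed.

End Partials.

Section HarmonicMeasure.
Context {R : realType}.
Implicit Types a x y : R.

Let p : R := pi / 2.
Let p_gt0 : 0 < p. Proof. by rewrite divr_gt0 ?pi_gt0. Qed.
Let pi0 : (pi : R) != 0. Proof. by rewrite gt_eqF ?pi_gt0. Qed.

(* The harmonic measure of [{1 + i s | s < a}] in the strip [0 < Re z < 1],
   seen from [x + i y]. *)
Definition hm a x y : R := x / 2 + pi^-1 * atan (tan (p * x) * tanh (p * (a - y))).

Let T x : R := tan (p * x).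
Let q a y : R := tanh (p * (a - y)).

Definition hmx a x y : R :=
  2^-1 + pi^-1 * (p * (1 + T x ^+ 2) * q a y / (1 + (T x * q a y) ^+ 2)).
Definition hmxx a x y : R :=
  pi^-1 * (2 * p ^+ 2 * T x * (1 + T x ^+ 2) * q a y * (1 - q a y ^+ 2)
           / (1 + (T x * q a y) ^+ 2) ^+ 2).
Definition hmy a x y : R :=
  pi^-1 * (- p * T x * (1 - q a y ^+ 2) / (1 + (T x * q a y) ^+ 2)).

Let den_neq0 (s : R) : 1 + s ^+ 2 != 0.
Proof. by rewrite gt_eqF// ltr_pwDl// sqr_ge0. Qed.

Lemma cos_strip x : 0 <= x -> x < 1 -> 0 < cos (p * x).
Proof.
move=> x0 x1; apply: cos_gt0_pihalf; apply/andP; split.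
  by rewrite (@lt_le_trans _ _ 0)// ?oppr_lt0// mulr_ge0// ltW.
by rewrite -[ltRHS]mulr1 ltr_pM2l.
Qed.

Lemma tan_strip_ge0 x : 0 <= x -> x < 1 -> 0 <= tan (p * x).
Proof.
move=> x0 x1; have := ltW (cos_strip x0 x1).
rewrite /tan => c0; rewrite divr_ge0// sin_ge0_pi// mulr_ge0 ?(ltW p_gt0)//=.
by rewrite /p; have := pi_gt0 R; nra.
Qed.

(** [atan (tan u * tanh v)] is the argument of [cos (u - i v)], which has no zero for
    [0 <= u < pi / 2]. So [hm a] is harmonic, and its second [y]-derivative is [- hmxx]. *)
Lemma hm_partials a x y : 0 <= x -> x < 1 ->
  partials (hm a) (hmx a) (hmxx a) (hmy a) (fun x y => - hmxx a x y) x y.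
Proof.
move=> x0 x1; have /lt0r_neq0 c0 := cos_strip x0 x1.
have dT : is_derive x 1 T (p * (1 + T x ^+ 2)).
  have d1 : is_derive x 1 (fun z : R => p * z) p.
    by apply: (is_derive_eq (derZ p (der_id x))); rewrite mulr1.
  apply: (is_derive_eq (@der_comp _ tan (fun z => p * z) x _ _ (is_derive_tan c0) d1)).
  by rewrite cos2_tan2// mulrC.
have dq : is_derive y 1 (q a) (- p * (1 - q a y ^+ 2)).
  have d1 : is_derive y 1 (fun z : R => p * (a - z)) (- p).
    apply: (is_derive_eq (derZ p (derB (der_cst a y) (der_id y)))).
    by rewrite sub0r mulrN1.
  by apply: (is_derive_eq (der_comp (der_tanh _) d1)); rewrite mulrC.
have dat (z : R) : is_derive z 1 atan (1 + z ^+ 2)^-1 := is_derive1_atan z.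
have dqc := der_cst (q a y) x; have dTc := der_cst (T x) y.
have dTq := derM dT dqc; have dqT := derM dTc dq.
have E := den_neq0 (T x * q a y).
rewrite /partials; split.
- apply: (is_derive_eq (derD (derM (der_id x) (der_cst 2^-1 x))
    (derZ pi^-1 (der_comp (dat _) dTq)))).
  rewrite /hmx; move: (pi^-1 : R) => c; field; exact: E.
- have dnum := derM (derZ p (derD (der_cst 1 x) (derM dT dT))) dqc.
  have dden := derV (derD (der_cst 1 x) (derM dTq dTq)) E.
  apply: (is_derive_eq (derD (der_cst 2^-1 x) (derZ pi^-1 (derM dnum dden)))).
  by rewrite /hmxx; move: (pi^-1 : R) => c; field; exact: E.
- apply: (is_derive_eq (derD (der_cst (x / 2) y)
    (derZ pi^-1 (der_comp (dat _) dqT)))).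
  by rewrite /hmy; move: (pi^-1 : R) => c; field; exact: E.
- have dnum := derZ (- p * T x) (derB (der_cst 1 y) (derM dq dq)).
  have dden := derV (derD (der_cst 1 y) (derM dqT dqT)) E.
  apply: (is_derive_eq (derZ pi^-1 (derM dnum dden))).
  by rewrite /hmxx; move: (pi^-1 : R) => c; field; exact: E.
Qed.

Lemma hm_continuous a x y : 0 <= x -> x < 1 ->
  {for (x, y), continuous (fun z : R * R => hm a z.1 z.2)}.
Proof.
move=> x0 x1; have /lt0r_neq0 c0 := cos_strip x0 x1.
have cx : z.1 @[z --> (x, y)] --> x by exact: cvg_fst.
have cy : z.2 @[z --> (x, y)] --> y by exact: cvg_snd.
apply: cvgD; first by apply: cvgM => //; exact: cvg_cst.
apply: cvgM; first exact: cvg_cst.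
apply: continuous_cvg; first exact: continuous_atan.
apply: cvgM.
  apply: continuous_cvg; first exact: continuous_tan.
  by apply: cvgM => //; exact: cvg_cst.
apply: continuous_cvg; first exact: der_continuous (der_tanh _).
apply: cvgM; first exact: cvg_cst.
by apply: cvgB => //; exact: cvg_cst.
Qed.

Lemma hm_at0 a y : hm a 0 y = 0.
Proof. by rewrite /hm mulr0 tan0 !mul0r atan0 mulr0 addr0. Qed.

Lemma atan_tan_strip x : 0 <= x -> x < 1 -> pi^-1 * atan (tan (p * x)) = x / 2.
Proof.
move=> x0 x1; rewrite tanK ?in_itv/=.
  by move: pi0; rewrite /p; move: (pi : R) => c c0; field; exact: c0.
by have := p_gt0; rewrite /p => p0; apply/andP; split; nra.
Qed.

Lemma hm_mono a b x y : 0 <= x -> x < 1 -> a <= b -> hm a x y <= hm b x y.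
Proof.
move=> x0 x1 ab; rewrite lerD2l ler_pM2l ?invr_gt0 ?pi_gt0//.
apply: le_atan; apply: ler_wpM2l; first exact: tan_strip_ge0.
by apply: tanh_mono; rewrite ler_pM2l// lerB.
Qed.

Lemma hm_ge0 a x y : 0 <= x -> x < 1 -> 0 <= hm a x y.
Proof.
move=> x0 x1; rewrite /hm -(atan_tan_strip x0 x1) -mulrDr mulr_ge0 ?invr_ge0 ?pi_ge0//.
rewrite addrC -lerBlDr sub0r -atanN le_atan// -mulrN1 ler_wpM2l ?tan_strip_ge0//.
exact/ltW/tanh_gtN1.
Qed.

Lemma hm_le a x y : 0 <= x -> x < 1 -> hm a x y <= x.
Proof.
move=> x0 x1; rewrite /hm {3}(splitr x) lerD2l -(atan_tan_strip x0 x1).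
rewrite ler_pM2l ?invr_gt0 ?pi_gt0//.
rewrite le_atan// ler_piMr ?tan_strip_ge0//.
exact/ltW/tanh_lt1.
Qed.

(** Since [x] is the harmonic measure of the whole right side, this is the mass of the right side
    outside the window of radius [r] around height [y]. It does not depend on [y], which makes the
    boundary estimates uniform. *)
Lemma hm_shift r x y : x - hm (y + r) x y + hm (y - r) x y =
  x - 2 / pi * atan (tan (p * x) * tanh (p * r)).
Proof.
have -> : hm (y + r) x y = x / 2 + pi^-1 * atan (tan (p * x) * tanh (p * r)).
  by rewrite /hm (_ : y + r - y = r)//; ring.
have -> : hm (y - r) x y = x / 2 - pi^-1 * atan (tan (p * x) * tanh (p * r)).
  by rewrite /hm (_ : y - r - y = - r); [rewrite mulrN tanhN mulrN atanN mulrN|ring].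
move: pi0 (atan _); move: (pi : R) => c c0 z; field; exact: c0.
Qed.

Lemma hmx0 a : hmx a 0 0 = 2^-1 + 2^-1 * tanh (p * a).
Proof.
rewrite /hmx /T /q mulr0 tan0 subr0 expr0n /= mul0r expr0n/= !addr0.
move: pi0 (tanh _); rewrite /p; move: (pi : R) => c c0 z; field; exact: c0.
Qed.

End HarmonicMeasure.

(** * Barriers with step boundary values *)

Section Strip.
Context {R : realType}.
Implicit Types x y s t : R.
Variables (w wx wxx wy wyy : R -> R -> R) (B L : R).
Hypothesis w_partials : forall x y : R, partials w wx wxx wy wyy x y.
Hypothesis w_bound : forall x y : R, 0 <= x <= 1 -> `|w x y| <= B.
Hypothesis wx_bound : forall x y : R, 0 <= x <= 1 -> `|wx x y| <= L.
Hypothesis wy_bound : forall x y : R, 0 <= x <= 1 -> `|wy x y| <= L.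

Let p : R := pi / 2.

Lemma strip_bound_ge0 : 0 <= B.
Proof. by apply: le_trans (w_bound (x := 0) 0 _); rewrite ?lexx ?ler01. Qed.

Lemma strip_slope_ge0 : 0 <= L.
Proof. by apply: le_trans (wx_bound (x := 0) 0 _); rewrite ?lexx ?ler01. Qed.

Lemma strip_lipschitz_x x y : 0 <= x <= 1 -> w x y - w 1 y <= L * (1 - x).
Proof.
move=> /andP[x0 x1].
have [||c] := @MVT_segment _ (w ^~ y) (wx ^~ y) x 1 x1.
- by move=> z _; have [] := w_partials z y.
- by apply: derivable_within_continuous => z _; have [[]] := w_partials z y.
rewrite in_itv/= => /andP[xc c1]; rewrite -[w x y - _]opprB => ->.
rewrite -mulNr ler_wpM2r ?subr_ge0//.
have := @wx_bound c y; rewrite (le_trans x0 xc) c1 => /(_ isT).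
by rewrite ler_norml => /andP[]; lra.
Qed.

Lemma strip_lipschitz_y s t : w 1 s - w 1 t <= L * `|s - t|.
Proof.
have key a b : a <= b -> `|w 1 b - w 1 a| <= L * (b - a).
  move=> ab; have [||c] := @MVT_segment _ (w 1) (wy 1) a b ab.
  - by move=> z _; have [] := w_partials 1 z.
  - by apply: derivable_within_continuous => z _; have [_ _ []] := w_partials 1 z.
  move=> _ ->; rewrite normrM (ger0_norm (_ : 0 <= b - a)) ?subr_ge0//.
  by rewrite ler_wpM2r ?subr_ge0// wy_bound// ler01 lexx.
case: (leP s t) => [st|/ltW ts].
  apply: le_trans (ler_norm _) _.
  by rewrite distrC (distrC s) (ger0_norm (_ : 0 <= t - s)) ?subr_ge0// key.
by apply: le_trans (ler_norm _) _; rewrite (ger0_norm (_ : 0 <= s - t)) ?subr_ge0// key.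
Qed.

Variables (a c : nat -> R) (r : R) (n : nat).
Hypothesis r_gt0 : 0 < r.
Hypothesis aS : forall j, a j.+1 = a j + r.
Hypothesis cE : forall j, c j = B - w 1 (a j) - 2 * L * r.

(* On the right boundary of the strip, [barrier] is [B - c j >= w 1 s] for [s]
   in the [j]-th cell of the grid, and [B] outside of the grid. *)
Definition barrier (x y : R) : R :=
  B * x - \sum_(j < n) c j * (hm (a j.+1) x y - hm (a j) x y).

Let c_le j : c j <= 2 * B.
Proof.
have := @w_bound 1 (a j); rewrite ler01 lexx ler_norml => /(_ isT) /andP[h _].
by rewrite cE; have := mulr_ge0 strip_slope_ge0 (ltW r_gt0); lra.
Qed.

Definition barrier_tail (x : R) : R := x - 2 / pi * atan (tan (p * x) * tanh (p * r)).

(** Near the right side the barrier averages the values [B - c j] by harmonic measure. Cells close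
    to height [y] have [B - c j >= w 1 y], as the margin [2 * L * r] in [c j] absorbs the variation
    of [w 1] over a distance [2 * r]. Distant cells only satisfy [c j <= 2 * B], but their total
    mass is at most [barrier_tail x]. *)
Lemma barrier_near_right x y : 0 <= x -> x < 1 ->
  w x y - barrier x y <= (L + B) * (1 - x) + 2 * B * barrier_tail x.
Proof.
move=> x0 x1.
have th_mono := @hm_mono R _ _ x y x0 x1.
pose th j := hm (a j) x y.
pose al := hm (y - r) x y; pose be := hm (y + r) x y.
(* [G] has slope 0 between [al] and [be] and slope 1 elsewhere: its increments measure the mass
   outside the window of radius [r] around [y]. *)
pose G s := Num.min s al + Num.max s be.
have Gmono s t : s <= t -> G s <= G t.
  by move=> st; exact: lerD (le_min2 st (lexx _)) (le_max2 st (lexx _)).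
have G1 s t : s <= t -> t <= al -> t - s <= G t - G s.
  move=> st ta; rewrite /G (min_idPl ta) (min_idPl (le_trans st ta)).
  have : Num.max s be <= Num.max t be := le_max2 st (lexx _).
  lra.
have G2 s t : s <= t -> be <= s -> t - s <= G t - G s.
  move=> st ta; rewrite /G (max_idPl ta) (max_idPl (le_trans ta st)).
  have : Num.min s al <= Num.min t al := le_min2 st (lexx _).
  lra.
have [wyB wyNB] : w 1 y <= B /\ - B <= w 1 y.
  by have := @w_bound 1 y; rewrite ler01 lexx ler_norml => /(_ isT) /andP[].
have B0 := strip_bound_ge0; have r0 := r_gt0.
have step j : c j * (th j.+1 - th j) <=
    (B - w 1 y) * (th j.+1 - th j) + 2 * B * (G (th j.+1) - G (th j)).
  have thj : th j <= th j.+1 by apply: th_mono; rewrite aS; lra.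
  have pj : 0 <= th j.+1 - th j by rewrite subr_ge0.
  have Gj : 0 <= G (th j.+1) - G (th j) by rewrite subr_ge0 Gmono.
  have cj := c_le j.
  have far : th j.+1 - th j <= G (th j.+1) - G (th j) ->
      c j * (th j.+1 - th j) <=
      (B - w 1 y) * (th j.+1 - th j) + 2 * B * (G (th j.+1) - G (th j)).
    move=> D; have : c j * (th j.+1 - th j) <= 2 * B * (th j.+1 - th j).
      exact: ler_wpM2r.
    have : 2 * B * (th j.+1 - th j) <= 2 * B * (G (th j.+1) - G (th j)).
      by apply: ler_wpM2l => //; lra.
    have : 0 <= (B - w 1 y) * (th j.+1 - th j) by apply: mulr_ge0 => //; lra.
    lra.
  (* Cells have length [r], so a cell whose left end is further than [2 * r] from [y] avoids the
     window of radius [r] entirely. *)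
  case: (leP `|y - a j| (2 * r)) => [near|]; last first.
    rewrite ltr_normr => /orP[h|h]; apply: far.
      by apply: G1 => //; apply: th_mono; rewrite aS; lra.
    by apply: G2 => //; apply: th_mono; lra.
  have : c j <= B - w 1 y.
    have h1 := strip_lipschitz_y y (a j); have : L * `|y - a j| <= L * (2 * r).
      by apply: ler_wpM2l => //; exact: strip_slope_ge0.
    by rewrite cE; lra.
  move=> cjB; have : c j * (th j.+1 - th j) <= (B - w 1 y) * (th j.+1 - th j).
    exact: ler_wpM2r.
  have : 0 <= 2 * B * (G (th j.+1) - G (th j)) by apply: mulr_ge0 => //; lra.
  lra.
have tele (F : nat -> R) : \sum_(j < n) (F j.+1 - F j) = F n - F 0%N.
  by rewrite -(big_mkord xpredT (fun j => F j.+1 - F j)) telescope_sumr.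
have sum_le : \sum_(j < n) c j * (th j.+1 - th j) <=
    (B - w 1 y) * (th n - th 0%N) + 2 * B * (G (th n) - G (th 0%N)).
  rewrite -(tele th) -(tele (G \o th)) !mulr_sumr -big_split /=.
  by apply: ler_sum => j _; exact: step.
have th_in j : 0 <= th j <= x by rewrite hm_ge0// hm_le.
have Gtail : G (th n) - G (th 0%N) <= barrier_tail x.
  rewrite /barrier_tail -(hm_shift r x y) -/al -/be /G.
  have /andP[t00 t0x] := th_in 0%N; have /andP[tn0 tnx] := th_in n.
  have : Num.min (th n) al <= al by rewrite ge_min lexx orbT.
  have : 0 <= Num.min (th 0%N) al by rewrite le_min t00 hm_ge0.
  have : Num.max (th n) be <= x by rewrite ge_max tnx hm_le.
  have : be <= Num.max (th 0%N) be by rewrite le_max lexx orbT.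
  lra.
have h1 : (B - w 1 y) * (th n - th 0%N) <= (B - w 1 y) * x.
  have /andP[t00 t0x] := th_in 0%N; have /andP[tn0 tnx] := th_in n.
  by apply: ler_wpM2l; lra.
have h2 : 2 * B * (G (th n) - G (th 0%N)) <= 2 * B * barrier_tail x.
  by apply: ler_wpM2l => //; lra.
have h3 := @strip_lipschitz_x x y; rewrite x0 (ltW x1) in h3; have {}h3 := h3 isT.
have h4 : w 1 y * (1 - x) <= B * (1 - x) by apply: ler_wpM2r; lra.
have : \sum_(j < n) c j * (th j.+1 - th j) <= (B - w 1 y) * x + 2 * B * barrier_tail x by lra.
rewrite /barrier -/th; have -> : \sum_(j < n) c j * (hm (a j.+1) x y - hm (a j) x y) =
  \sum_(j < n) c j * (th j.+1 - th j) by [].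
by move: (\sum_(j < n) _) => S; lra.
Qed.

(** A crude bound valid at all heights, for the top and bottom sides of the rectangle, where the
    penalty outweighs it. *)
Lemma barrier_bound x y : 0 <= x -> x < 1 -> w x y - barrier x y <= 2 * B.
Proof.
move=> x0 x1; have B0 := strip_bound_ge0; have r0 := r_gt0.
have : \sum_(j < n) c j * (hm (a j.+1) x y - hm (a j) x y) <= 2 * B * x.
  apply: (@le_trans _ _ (2 * B * \sum_(j < n) (hm (a j.+1) x y - hm (a j) x y))).
    rewrite mulr_sumr; apply: ler_sum => j _; rewrite ler_wpM2r// subr_ge0.
    by apply: hm_mono => //; rewrite aS; lra.
  rewrite -(big_mkord xpredT (fun j => hm (a j.+1) x y - hm (a j) x y)) telescope_sumr//.
  apply: ler_wpM2l; first lra.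
  by have := hm_ge0 (a 0%N) y x0 x1; have := hm_le (a n) y x0 x1; lra.
have := @w_bound x y; rewrite x0 (ltW x1) => /(_ isT); rewrite ler_norml => /andP[_ h].
rewrite /barrier; move: (\sum_(j < n) _) => S hS.
have : B * x <= B * 1 by apply: ler_wpM2l => //; exact: ltW.
lra.
Qed.

Lemma barrier_tail_small (e : R) (x0 : R) : 0 < e -> x0 < 1 ->
  exists x, [/\ x0 <= x, 0 <= x, x < 1, 1 - x <= e & barrier_tail x <= e].
Proof.
move=> e0 x01.
have pi0 := pi_gt0 R; have p0 : 0 < p by rewrite /p; lra.
have tau0 : 0 < tanh (p * r) by rewrite tanh_gt0// mulr_gt0.
have := @cvgy_atan R.
move=> /cvgr_gt /(_ (pi / 2 - Num.min e (Num.min 1 (1 - x0)))).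
set e' := Num.min e _; have e'0 : 0 < e'.
  by rewrite !lt_min e0 ltr01 subr_gt0 x01.
have e'e : e' <= e by rewrite /e' ge_min lexx.
have e'1 : e' <= 1 by rewrite /e' !ge_min lexx !orbT.
have e'x : e' <= 1 - x0 by rewrite /e' !ge_min lexx !orbT.
case; first lra.
move=> M [_ HM].
(* The witness [x] will satisfy [tan (p * x) = Z], and [Z] is so large that [atan Z] and
   [atan (Z * tanh (p * r))] both exceed [pi / 2 - e']. *)
pose Z := Num.max (M + 1) ((M + 1) / tanh (p * r)).
have Z1 : M < Z by rewrite lt_max ltrDl ltr01.
have Z2 : M < Z * tanh (p * r).
  rewrite -ltr_pdivrMr// lt_max [X in _ || X](_ : _ = true) ?orbT//.
  by rewrite ltr_pM2r ?invr_gt0// ltrDl ltr01.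
have /= := HM _ Z1; have /= := HM _ Z2.
set A1 := atan (Z * _); set A2 := atan Z => h1 h2.
have A2lt : A2 < pi / 2 by exact: atan_ltpi2.
have p1 : 1 <= p by exact: pihalf_ge1.
have pinv : p * (A2 / p) = A2 by field; exact: lt0r_neq0.
have x1 : A2 / p < 1 by rewrite ltr_pdivrMr// mul1r.
have xe : 1 - e' <= A2 / p.
  rewrite ler_pdivlMr//.
  have : p - e' < A2 by [].
  have : 1 * e' <= p * e' by rewrite ler_wpM2r// ltW.
  lra.
exists (A2 / p); split => //; try lra.
rewrite /barrier_tail pinv atanK -/A1.
have : 1 - e' <= 2 / pi * A1.
  rewrite -ler_pdivrMl ?divr_gt0// invf_div.
  have : p - e' < A1 by [].
  have : 1 * e' <= p * e' by rewrite ler_wpM2r// ltW.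
  rewrite /p; lra.
lra.
Qed.

End Strip.

Section StripMaximum.
Context {R : realType}.
Implicit Types x y s t : R.
Variables (w wx wxx wy wyy : R -> R -> R) (B L : R).
Hypothesis w_partials : forall x y, partials w wx wxx wy wyy x y.
Hypothesis w_sub : forall x y, 0 <= wxx x y + wyy x y.
Hypothesis w_cont : continuous (fun z : R * R => w z.1 z.2).
Hypothesis w_bound : forall x y, 0 <= x <= 1 -> `|w x y| <= B.
Hypothesis wx_bound : forall x y, 0 <= x <= 1 -> `|wx x y| <= L.
Hypothesis wy_bound : forall x y, 0 <= x <= 1 -> `|wy x y| <= L.
Hypothesis w_left : forall y, w 0 y <= 0.
Hypothesis w00 : w 0 0 = 0.
Variables (a c : nat -> R) (r : R) (n : nat).
Hypothesis r_gt0 : 0 < r.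
Hypothesis aS : forall j, a j.+1 = a j + r.
Hypothesis cE : forall j, c j = B - w 1 (a j) - 2 * L * r.

Let u := barrier B a c n.
Let ux x y := B - \sum_(j < n) c j * (hmx (a j.+1) x y - hmx (a j) x y).
Let uxx x y := 0 - \sum_(j < n) c j * (hmxx (a j.+1) x y - hmxx (a j) x y).
Let uy x y := 0 - \sum_(j < n) c j * (hmy (a j.+1) x y - hmy (a j) x y).
Let uyy x y := 0 - \sum_(j < n) c j * (- hmxx (a j.+1) x y - - hmxx (a j) x y).

Let u_partials x y : 0 <= x -> x < 1 -> partials u ux uxx uy uyy x y.
Proof.
move=> x0 x1; apply: (@partialsB _ (fun x _ => B * x) (fun _ _ => B)
  (fun _ _ => 0) (fun _ _ => 0) (fun _ _ => 0)).
  split; try exact: der_cst.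
  by apply: (is_derive_eq (derZ B (der_id x))); rewrite mulr1.
apply: (@partials_sum _ n (fun j x y => c j * (hm (a j.+1) x y - hm (a j) x y))
  (fun j x y => c j * (hmx (a j.+1) x y - hmx (a j) x y))
  (fun j x y => c j * (hmxx (a j.+1) x y - hmxx (a j) x y))
  (fun j x y => c j * (hmy (a j.+1) x y - hmy (a j) x y))
  (fun j x y => c j * (- hmxx (a j.+1) x y - - hmxx (a j) x y))) => j.
apply: (partialsZ (c j) (w := fun x y => hm (a j.+1) x y - hm (a j) x y)).
by apply: partialsB; exact: hm_partials.
Qed.

Let u_harmonic x y : uxx x y + uyy x y = 0.
Proof.
rewrite /uxx /uyy !sub0r -opprD -big_split big1 ?oppr0// => j _ /=.
ring.
Qed.

(** A penalty with Laplacian [-2] that dominates [y * y] on the strip: it makes the comparison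
    strict and controls large heights. *)
Let v x y : R := y * y + 2 - 2 * (x * x).

Let v_partials x y : partials v (fun x y => - (4 * x)) (fun x y => - 4)
  (fun x y => 2 * y) (fun x y => 2) x y.
Proof.
split.
- apply: (is_derive_eq (derB (der_cst (y * y + 2) x) (derZ 2 (derM (der_id x) (der_id x))))).
  by ring.
- by apply: (is_derive_eq (derN (derZ 4 (der_id x)))); rewrite mulr1.
- apply: (is_derive_eq (derB (derD (derM (der_id y) (der_id y)) (der_cst 2 y)) (der_cst _ y))).
  by ring.
- by apply: (is_derive_eq (derZ 2 (der_id y))); rewrite mulr1.
Qed.

Lemma le_barrier x : 0 <= x -> x < 1 -> w x 0 <= u x 0.
Proof.
move=> x0 x1; have B0 := strip_bound_ge0 w_bound; have L0 := strip_slope_ge0 wx_bound.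
apply/ler_addgt0Pr => e e0.
(* Half of [e] pays for the side [x = X], where [barrier_near_right] loses at most
   [(L + 3 * B) * e1]. The other half pays for the penalty, at most [2 * d] on the real axis. The
   height [Y] makes [d * Y * Y] outweigh the [2 * B] of [barrier_bound]. *)
pose e1 := e / 2 / (L + 3 * B + 1).
have den0 : 0 < L + 3 * B + 1 by lra.
have e10 : 0 < e1 by rewrite !divr_gt0.
have e1E : (L + 3 * B + 1) * e1 = e / 2 by rewrite mulrC /e1 divfK// gt_eqF.
have [X [xX X0 X1 hX tX]] := barrier_tail_small r_gt0 e10 x1.
pose d := e / 4; have d0 : 0 < d by rewrite /d; lra.
pose Y := 1 + 2 * B / d.
have Y1 : 1 <= Y by rewrite /Y lerDl divr_ge0//; lra.
have dY : 2 * B <= d * (Y * Y).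
  have : d * Y = d + 2 * B by rewrite /Y mulrDr mulr1 mulrCA divff ?mulr1// gt_eqF.
  have : d * Y * 1 <= d * Y * Y by apply: ler_wpM2l => //; apply: mulr_ge0; lra.
  rewrite mulrA; move: (d * Y) (d * Y * Y) => dY1 dY2; lra.
pose g x y := w x y - u x y - d * v x y.
suff : g x 0 <= e / 2.
  rewrite /g /v mul0r add0r.
  have : d * (2 - 2 * (x * x)) <= d * 2.
    by apply: ler_wpM2l; [exact: ltW|have := mulr_ge0 x0 x0; lra].
  rewrite /d; lra.
have v_ge s t : 0 <= s <= 1 -> t * t <= v s t.
  move=> /andP[s0 s1]; have : s * s <= 1 by rewrite mulr_ile1.
  by rewrite /v; lra.
have dv_ge0 s t : 0 <= s <= 1 -> 0 <= d * v s t.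
  move=> s01; apply: mulr_ge0; first exact: ltW.
  by apply: le_trans (v_ge s t s01); rewrite -expr2 sqr_ge0.
have in01 s : 0 <= s <= X -> 0 <= s <= 1.
  by move=> /andP[-> h]; rewrite (le_trans h (ltW X1)).
have sX s : 0 <= s <= X -> s < 1 by move=> /andP[_ h]; rewrite (le_lt_trans h X1).
have g_far s t : 0 <= s <= X -> t * t = Y * Y -> g s t <= e / 2.
  move=> sh tY; have := v_ge s t (in01 _ sh); rewrite tY => /(ler_wpM2l (ltW d0)).
  have /andP[s0 _] := sh.
  have := barrier_bound w_bound wx_bound n r_gt0 aS cE t s0 (sX _ sh).
  by rewrite -/u /g; lra.
apply: (@strict_subharmonic_max _ g
  (fun x y => wx x y - ux x y - d * - (4 * x))
  (fun x y => wy x y - uy x y - d * (2 * y))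
  (fun x y => wxx x y - uxx x y - d * - 4)
  (fun x y => wyy x y - uyy x y - d * 2) 0 X (- Y) Y (e / 2)).
- exact: X0.
- lra.
- apply: continuous_in_subspaceT => -[s t] /set_mem[/= + _].
  rewrite in_itv/= => sh; have /andP[s0 _] := sh.
  have cs : z.1 @[z --> (s, t)] --> s by exact: cvg_fst.
  have ct : z.2 @[z --> (s, t)] --> t by exact: cvg_snd.
  apply: cvgB; last first.
    apply: cvgM; first exact: cvg_cst.
    apply: cvgB.
      by apply: cvgD; [apply: cvgM|exact: cvg_cst].
    by apply: cvgM; [exact: cvg_cst|apply: cvgM].
  apply: cvgB; first exact: w_cont.
  apply: cvgB; first by apply: cvgM => //; exact: cvg_cst.
  apply: cvg_big => [|j _]; first exact: add_continuous.
  apply: cvgM; first exact: cvg_cst.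
  by apply: cvgB; apply: hm_continuous => //; exact: sX.
- move=> s t /andP[s0 s1] _; have s01 : s < 1 by exact: lt_trans X1.
  have [h1 h2 h3 h4] := partialsB (partialsB (w_partials s t) (u_partials t (ltW s0) s01))
    (partialsZ d (v_partials s t)).
  split=> //.
  have := w_sub s t; have := u_harmonic s t; lra.
- move=> t _; have := w_left t; have := dv_ge0 0 t; rewrite lexx ler01 => /(_ isT).
  rewrite /g /u /barrier mulr0 big1 => [|j _]; last by rewrite !hm_at0 subrr mulr0.
  by lra.
- move=> t _.
  have := barrier_near_right w_partials w_bound wx_bound wy_bound n r_gt0 aS cE t X0 X1.
  have := dv_ge0 X t; rewrite X0 (ltW X1) => /(_ isT).
  have : (L + B) * (1 - X) <= (L + B) * e1 by apply: ler_wpM2l => //; lra.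
  have : 2 * B * barrier_tail r X <= 2 * B * e1 by apply: ler_wpM2l => //; lra.
  rewrite -/u /g; lra.
- by move=> s sh; apply: g_far => //; ring.
- by move=> s sh; apply: g_far.
- by rewrite x0.
- by apply/andP; split; lra.
Qed.

(** [w] and the barrier both vanish at the origin, so their comparison along the real axis passes to
    the derivatives. *)
Lemma derivative_le_barrier :
  wx 0 0 <= B - \sum_(j < n) c j * (hmx (a j.+1) 0 0 - hmx (a j) 0 0).
Proof.
rewrite leNgt; apply/negP => h.
have [dw _ _ _] := w_partials 0 0.
have [|du _ _ _] := @u_partials 0 0 (lexx _); first exact: ltr01.
have := der_pos_right (derB dw du); rewrite subr_gt0 => /(_ h) [e e0 He].
have u00 : u 0 0 = 0.
  by rewrite /u /barrier mulr0 big1 ?subr0// => j _; rewrite !hm_at0 subrr mulr0.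
pose x := Num.min (e / 2) (2^-1).
have x0 : 0 < x by rewrite lt_min divr_gt0//= invr_gt0.
have xe : x < 0 + e.
  by apply: (@le_lt_trans _ _ (e / 2)); [rewrite ge_min lexx|lra].
have x1 : x < 1.
  by apply: (@le_lt_trans _ _ (2^-1)); [rewrite ge_min lexx orbT|lra].
have := He x x0 xe; have := le_barrier (ltW x0) x1.
by rewrite w00 u00; lra.
Qed.

End StripMaximum.

(** * The boundary derivative of subharmonic functions on the strip *)

Section Beta0.
Context {R : realType}.
Implicit Types s t : R.
Local Notation mu := lebesgue_measure.

Lemma beta0_gt0 t : 0 < beta0 t :> R.
Proof.
rewrite /beta0 divr_gt0 ?pi_gt0// mulr_gt0// ltr_wpDl// /cosh.
by rewrite divr_ge0// addr_ge0// expR_ge0.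
Qed.

Lemma der_tanh_beta0 t :
  is_derive t 1 (fun s : R => 2^-1 + 2^-1 * tanh (pi / 2 * s)) (beta0 t).
Proof.
have d1 : is_derive t 1 (fun z : R => pi / 2 * z) (pi / 2).
  by apply: (is_derive_eq (derZ (pi / 2) (der_id t))); rewrite mulr1.
apply: (is_derive_eq (derD (der_cst 2^-1 t) (derZ 2^-1 (der_comp (der_tanh _) d1)))).
rewrite add0r /beta0 /cosh.
have -> : expR (pi * t) = expR (pi / 2 * t) ^+ 2.
  by rewrite -expRM_natl; congr expR; move: (pi : R) => c; field.
have -> : expR (- (pi * t)) = expR (- (pi / 2 * t)) ^+ 2.
  by rewrite -expRM_natl; congr expR; move: (pi : R) => c; field.
have := expR_gt0 (pi / 2 * t); have : expR (- (pi / 2 * t)) * expR (pi / 2 * t) = 1.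
  by rewrite -expRD addNr expR0.
rewrite /tanh; set u := expR (- _); set v := expR _; move: u v (pi : R) => u v c uv v0.
have u0 : 0 < u by rewrite -(pmulr_lgt0 u v0) uv.
have -> : (v ^+ 2 + u ^+ 2) / 2 + 1 = (v + u) ^+ 2 / 2.
  by rewrite -[X in _ + X = _]uv; field.
have -> : 1 - ((v - u) / (v + u)) ^+ 2 = 4 * (u * v) / (v + u) ^+ 2.
  by field; rewrite gt_eqF// addr_gt0.
by rewrite uv; field; rewrite gt_eqF// addr_gt0.
Qed.

Lemma beta0_continuous : continuous (@beta0 R).
Proof.
move=> t; apply: cvgM; first exact: cvg_cst.
apply: cvgV.
  rewrite mulf_neq0// gt_eqF// ltr_wpDl// /cosh.
  by rewrite divr_ge0// addr_ge0// expR_ge0.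
apply: cvgM; first exact: cvg_cst.
apply: cvgD; last exact: cvg_cst.
apply: cvgM; last exact: cvg_cst.
have ct : (pi : R) * x @[x --> t] --> pi * t by apply: cvgM; [exact: cvg_cst|].
apply: cvgD; (apply: continuous_cvg; first exact: continuous_expR) => //.
exact: cvgN.
Qed.

Lemma integral_primitive (f P : R -> R) (a b : R) : continuous f -> a < b ->
  (forall t, a <= t <= b -> is_derive t 1 P (f t)) ->
  (\int[mu]_(t in `[a, b]) (f t)%:E = (P b - P a)%:E)%E.
Proof.
move=> cf ab dP; rewrite EFinB; apply: continuous_FTC2 => //.
- exact: continuous_subspaceT.
- split.
  + by move=> t; rewrite in_itv/= => /andP[at_ tb]; case: (dP t); rewrite ?ltW.
  + by apply: cvg_at_right_filter; apply: der_continuous (dP _ _); rewrite lexx ltW.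
  + by apply: cvg_at_left_filter; apply: der_continuous (dP _ _); rewrite lexx ltW.
- move=> t; rewrite in_itv/= => /andP[at_ tb].
  by case: (dP t) => [|_ <-]; rewrite ?ltW// derive1E.
Qed.

Lemma exists_primitive (f : R -> R) (a : R) : continuous f ->
  exists P : R -> R, forall t, a <= t -> is_derive t 1 P (f t).
Proof.
move=> cf.
have fi u v : mu.-integrable `[u, v] (EFin \o f).
  apply: continuous_compact_integrable; first exact: segment_compact.
  exact: continuous_subspaceT.
(* Starting the integral at [a - 1] makes [a] itself an interior point, as a two-sided derivative
   requires. *)
exists (fun x => (\int[mu]_(t in [set` `[(a - 1), x]]) (f t))%R) => t at_.
have t1 : t < t + 1 by rewrite ltrDl.
have at1 : a - 1 < t by rewrite ltrBlDr (le_lt_trans at_)// ltrDl.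
have [d1 d2] := continuous_FTC1_closed t1 (fi (a - 1) (t + 1)) at1 (cf t).
by apply: DeriveDef; [exact: d1|rewrite -derive1E; exact: d2].
Qed.

Lemma symmetric_integral_cvg (f : R -> R) : continuous f -> (forall t, 0 <= f t) ->
  (\int[mu]_(t in `[(- n%:R)%R, n%:R%R]) (f t)%:E)%E @[n --> \oo] -->
    (\int[mu]_t (f t)%:E)%E.
Proof.
move=> cf f0.
have mf : measurable_fun [set: R] f by exact: continuous_measurable_fun.
have := @ge0_nondecreasing_set_cvg_integral _ (measurableTypeR R) R
  (fun n : nat => [set` `[(- n%:R : R), n%:R]]) (EFin \o f) mu.
rewrite (_ : \bigcup_i _ = setT).
  apply.
  - move=> m n mn; rewrite subsetEset; apply: subset_itv; rewrite bnd_simp ?lerN2 ler_nat//.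
  - by move=> i; exact: measurable_itv.
  - by move=> i; apply/measurable_EFinP; exact: measurable_funTS.
  - by move=> i x _; rewrite lee_fin.
apply/seteqP; split => // x _; exists (Num.truncn `|x|).+1 => //=.
by rewrite in_itv/= -ler_norml ltW// truncnS_gt.
Qed.

Lemma integral_beta0 : (\int[mu]_t (beta0 t : R)%:E = 1)%E.
Proof.
have H := symmetric_integral_cvg beta0_continuous (fun t => ltW (beta0_gt0 t)).
apply: (cvg_unique _ H) => //=.
have p0 : 0 < pi / 2 :> R by rewrite divr_gt0 ?pi_gt0.
have key n : (0 < n)%N -> (\int[mu]_(t in `[(- n%:R)%R, n%:R%R]) (beta0 t)%:E)%E =
    (tanh (pi / 2 * n%:R) : R)%:E.
  move=> n0; rewrite (integral_primitive beta0_continuous _ (fun t _ => der_tanh_beta0 t)).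
    by congr EFin; rewrite mulrN tanhN mulrN; lra.
  by rewrite (@lt_trans _ _ 0)// ?oppr_lt0 ltr0n.
suff h : (tanh (pi / 2 * n%:R) : R) @[n --> \oo] --> (1 : R).
  apply: cvg_EFin.
    by near=> n; rewrite key//; near: n; exact: nbhs_infty_gt.
  apply: cvg_trans h; apply: near_eq_cvg; near=> n.
  by rewrite /= key//; near: n; exact: nbhs_infty_gt.
apply/cvgrPdist_le => e e0.
have [s s0 hs] := tanh_near1 e0.
near=> n.
rewrite ger0_norm; last by rewrite subr_ge0 ltW ?tanh_lt1.
rewrite lerBlDr addrC -lerBlDr.
apply: le_trans hs _; apply: tanh_mono.
rewrite -ler_pdivrMl//; near: n; exact: nbhs_infty_ger.
Unshelve. all: by end_near. Qed.

(* Monotonicity without any measurability assumption on the larger function. *)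
Lemma le_integral_nonmeasurable (f g : R -> \bar R) : (forall t, (f t <= g t)%E) ->
  (\int[mu]_t f t <= \int[mu]_t g t)%E.
Proof.
move=> fg; rewrite /integral !patch_setT; apply: leeB.
  apply: le_ereal_sup => _ [h hf <-]; exists h => // x.
  by apply: le_trans (hf x) _; rewrite !funepos.unlock; exact: le_max2.
apply: le_ereal_sup => _ [h hg <-]; exists h => // x.
apply: le_trans (hg x) _; rewrite !funeneg.unlock; apply: le_max2 => //.
by rewrite leeN2.
Qed.

End Beta0.

(** * From barriers to the integral against [beta0] *)

Section StripInequality.
Context {R : realType}.
Implicit Types x y s t : R.
Local Notation mu := lebesgue_measure.
Variables (w wx wxx wy wyy : R -> R -> R) (B L : R).
Hypothesis w_partials : forall x y, partials w wx wxx wy wyy x y.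
Hypothesis w_sub : forall x y, 0 <= wxx x y + wyy x y.
Hypothesis w_cont : continuous (fun z : R * R => w z.1 z.2).
Hypothesis w_bound : forall x y, 0 <= x <= 1 -> `|w x y| <= B.
Hypothesis wx_bound : forall x y, 0 <= x <= 1 -> `|wx x y| <= L.
Hypothesis wy_bound : forall x y, 0 <= x <= 1 -> `|wy x y| <= L.
Hypothesis w_left : forall y, w 0 y <= 0.
Hypothesis w00 : w 0 0 = 0.

Let w1_cont : continuous (w 1).
Proof. by move=> t; apply: der_continuous; case: (w_partials 1 t) => _ _ []. Qed.

Let w1_in t : - B <= w 1 t <= B.
Proof. by rewrite -ler_norml w_bound// ler01 lexx. Qed.

Let defect t := (B - w 1 t) * beta0 t.

Let defect_cont : continuous defect.
Proof.
move=> t; apply: cvgM; last exact: beta0_continuous.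
by apply: cvgB; [exact: cvg_cst|exact: w1_cont].
Qed.

Let defect_ge0 t : 0 <= defect t.
Proof.
by apply: mulr_ge0; [rewrite subr_ge0; case/andP: (w1_in t)|exact/ltW/beta0_gt0].
Qed.

Let b t : R := 2^-1 + 2^-1 * tanh (pi / 2 * t).

(** By [hmx0] the derivative of the barrier is a Riemann-Stieltjes sum against [b], a primitive of
    [beta0]. On the [j]-th cell [c j + 3 * L * r] dominates [B - w 1]: two units of [L * r] undo the
    margin built into [c j], the third covers the oscillation of [w 1]. As [b] grows by at most 1 in
    total, the loss is [3 * L * r]. *)
Lemma derivative_le_grid (T : R) (P : R -> R) (n : nat) : 0 < T -> (0 < n)%N ->
  (forall t, - T <= t <= T -> is_derive t 1 P (defect t)) ->
  wx 0 0 <= B - (P T - P (- T)) + 3 * L * (2 * T / n%:R).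
Proof.
move=> T0 n0 dP; have L0 := strip_slope_ge0 wx_bound.
pose r := 2 * T / n%:R; have nR : 0 < n%:R :> R by rewrite ltr0n.
have r0 : 0 < r by rewrite divr_gt0// mulr_gt0.
pose a (j : nat) := - T + r * j%:R.
pose c (j : nat) := B - w 1 (a j) - 2 * L * r.
have aS j : a j.+1 = a j + r by rewrite /a -addn1 natrD mulrDr mulr1 addrA.
have a0 : a 0%N = - T by rewrite /a mulr0 addr0.
have an : a n = T by rewrite /a /r divfK ?gt_eqF//; lra.
have amono i j : (i <= j)%N -> a i <= a j.
  by move=> ij; rewrite lerD2l ler_pM2l// ler_nat.
have H := derivative_le_barrier w_partials w_sub w_cont w_bound wx_bound wy_bound
  w_left w00 n r0 aS (fun j => erefl (c j)).
apply: le_trans H _; rewrite -/r.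
have tele (F : nat -> R) : \sum_(j < n) (F j.+1 - F j) = F n - F 0%N.
  by rewrite -(big_mkord xpredT (fun j => F j.+1 - F j)) telescope_sumr.
have -> : \sum_(j < n) c j * (hmx (a j.+1) 0 0 - hmx (a j) 0 0) =
    \sum_(j < n) c j * (b (a j.+1) - b (a j)).
  by apply: eq_bigr => j _; rewrite !hmx0.
have step (j : 'I_n) : P (a j.+1) - P (a j) <=
    (c j + 3 * L * r) * (b (a j.+1) - b (a j)).
  pose k := c j + 3 * L * r.
  pose D t := k * b t - P t.
  have aj : a j <= a j.+1 by exact: amono.
  have jT t : a j <= t <= a j.+1 -> - T <= t <= T.
    move=> /andP[h1 h2]; rewrite -{1}a0 -an (le_trans (amono _ _ (leq0n j)) h1).
    by rewrite (le_trans h2)// amono.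
  have dD t : a j <= t <= a j.+1 -> is_derive t 1 D (k * beta0 t - defect t).
    by move=> /jT/dP h; exact: (derB (derZ k (der_tanh_beta0 t)) h).
  have [||t] := @MVT_segment _ D (fun t => k * beta0 t - defect t) (a j) (a j.+1) aj.
  - by move=> t; rewrite in_itv/= => /andP[h1 h2]; apply: dD; rewrite !ltW.
  - apply: derivable_within_continuous => t; rewrite in_itv/= => h.
    by case: (dD _ h).
  rewrite in_itv/= => /andP[h1 h2] E.
  suff : 0 <= D (a j.+1) - D (a j) by rewrite /D -/k; lra.
  rewrite E; apply: mulr_ge0; last by rewrite subr_ge0.
  rewrite subr_ge0 /defect; apply: ler_wpM2r; first exact/ltW/beta0_gt0.
  have := strip_lipschitz_y w_partials wy_bound (a j) t.
  have : L * `|a j - t| <= L * r.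
    apply: ler_wpM2l => //; rewrite distrC ger0_norm ?subr_ge0//.
    by move: h2; rewrite aS; lra.
  rewrite /k /c; lra.
have : P T - P (- T) <= \sum_(j < n) (c j + 3 * L * r) * (b (a j.+1) - b (a j)).
  have -> : P T - P (- T) = P (a n) - P (a 0%N) by rewrite an a0.
  by rewrite -(tele (P \o a)); apply: ler_sum => j _; exact: step.
have -> : \sum_(j < n) (c j + 3 * L * r) * (b (a j.+1) - b (a j)) =
  \sum_(j < n) c j * (b (a j.+1) - b (a j)) + 3 * L * r * (b (a n) - b (a 0%N)).
  rewrite -(tele (b \o a)) mulr_sumr -big_split /=.
  by apply: eq_bigr => j _; rewrite mulrDl.
have : 3 * L * r * (b (a n) - b (a 0%N)) <= 3 * L * r * 1.
  apply: ler_wpM2l; first by rewrite !mulr_ge0// ltW.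
  rewrite /b; have := tanh_lt1 (pi / 2 * a n); have := tanh_gtN1 (pi / 2 * a 0%N); lra.
move: (\sum_(j < n) _) => S; lra.
Qed.

Lemma derivative_le_segment (T : R) (P : R -> R) : 0 < T ->
  (forall t, - T <= t <= T -> is_derive t 1 P (defect t)) ->
  P T - P (- T) <= B - wx 0 0.
Proof.
move=> T0 dP; have L0 := strip_slope_ge0 wx_bound.
apply/ler_addgt0Pr => e e0.
pose n := (Num.truncn (6 * L * T / e)).+1.
have := derivative_le_grid T0 (ltn0Sn _ : (0 < n)%N) dP.
have nR : 0 < n%:R :> R by rewrite ltr0n.
suff : 3 * L * (2 * T / n%:R) <= e by lra.
rewrite mulrA ler_pdivrMr// -ler_pdivrMl//.
apply/ltW/(le_lt_trans _ (truncnS_gt _)).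
by rewrite le_eqVlt; apply/orP; left; apply/eqP; ring.
Qed.

(** The shift by [B] makes the integrand nonnegative, so the bounds on the segments [[-n, n]] pass
    to the line by monotone convergence. *)
Lemma integral_defect_le : (\int[mu]_t (defect t)%:E <= (B - wx 0 0)%:E)%E.
Proof.
have H := symmetric_integral_cvg defect_cont defect_ge0.
apply: (cvge_le _ H) => //; near=> n.
have n0 : (0 : R) < n%:R by rewrite ltr0n; near: n; exact: nbhs_infty_gt.
have [P dP] := exists_primitive (- n%:R : R) defect_cont.
have dP' t : - n%:R <= t <= n%:R -> is_derive t 1 P (defect t).
  by move=> /andP[+ _]; exact: dP.
rewrite (integral_primitive defect_cont _ dP') ?lee_fin.
  exact: derivative_le_segment.
by rewrite (@lt_trans _ _ 0)// ?oppr_lt0.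
Unshelve. all: by end_near. Qed.

(** Only the continuous minorant [(k + w 1 t) * beta0 t] is split and integrated; [h] enters through
    the pointwise comparison alone and may be any function. *)
Lemma strip_derivative_le (k : R) (h : R -> R) : (forall t, k + w 1 t <= h t) ->
  ((k + wx 0 0)%:E <= \int[mu]_t (h t * beta0 t)%:E)%E.
Proof.
move=> hh.
have meas (f : R -> R) : continuous f -> measurable_fun [set: R] (fun t => (f t)%:E).
  by move=> cf; apply/measurable_EFinP; exact: continuous_measurable_fun.
have bint : mu.-integrable [set: R] (fun t => (beta0 t : R)%:E).
  apply/integrableP; split; first exact: meas beta0_continuous.
  under eq_integral do rewrite gee0_abs ?lee_fin ?(ltW (beta0_gt0 _))//.
  by rewrite integral_beta0 ltry.
have dint : mu.-integrable [set: R] (fun t => (defect t)%:E).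
  apply/integrableP; split; first exact: meas defect_cont.
  under eq_integral do rewrite gee0_abs ?lee_fin ?defect_ge0//.
  by rewrite (le_lt_trans integral_defect_le)// ltry.
have kbint : mu.-integrable [set: R] (fun t => (k + B)%:E * (beta0 t : R)%:E)%E.
  exact: integrableZl.
apply: (@le_trans _ _ (\int[mu]_t ((k + B)%:E * (beta0 t)%:E - (defect t)%:E)%E)%E); last first.
  apply: le_integral_nonmeasurable => t.
  rewrite -EFinM -EFinB lee_fin /defect -mulrBl.
  by apply: ler_wpM2r; [exact/ltW/beta0_gt0|have := hh t; lra].
rewrite integralB// integralZl// integral_beta0 mule1.
have := integral_defect_le.
have : (\int[mu]_t (defect t)%:E)%E \is a fin_num by exact: integrable_fin_num.
case: (\int[mu]_t _)%E => [v _| |]//=.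
by rewrite -EFinB !lee_fin; lra.
Qed.

End StripInequality.

(** * Exponential sums *)

Section StripSubharmonic.
Context {R : realType}.
Implicit Types x y s t : R.
Local Notation mu := lebesgue_measure.

(* The last conjunct fixes the inner normal derivative of [w] at [0]. *)
Definition strip_subharmonic (w : R -> R -> R) (d : R) : Prop :=
  exists (wx wxx wy wyy : R -> R -> R) (B L : R),
  [/\ (forall x y, partials w wx wxx wy wyy x y),
      (forall x y, 0 <= wxx x y + wyy x y),
      continuous (fun z : R * R => w z.1 z.2) &
   [/\ (forall x y, 0 <= x <= 1 -> `|w x y| <= B),
      (forall x y, 0 <= x <= 1 -> `|wx x y| <= L),
      (forall x y, 0 <= x <= 1 -> `|wy x y| <= L) &
   [/\ (forall y, w 0 y <= 0), w 0 0 = 0 & wx 0 0 = d]]].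

Lemma strip_subharmonic_le w d (k : R) (h : R -> R) : strip_subharmonic w d ->
  (forall t, k + w 1 t <= h t) ->
  ((k + d)%:E <= \int[mu]_t (h t * beta0 t)%:E)%E.
Proof.
move=> [wx [wxx [wy [wyy [B [L [H1 H2 H3 [H4 H5 H6 [H7 H8 <-]]]]]]]]].
exact: strip_derivative_le H1 H2 H3 H4 H5 H6 H7 H8 k h.
Qed.

Lemma strip_subharmonic0 : strip_subharmonic (fun _ _ => 0) 0.
Proof.
exists (fun _ _ => 0), (fun _ _ => 0), (fun _ _ => 0), (fun _ _ => 0), 0, 0.
split; last by split; [| | |split] => *; rewrite ?normr0 ?lexx.
- by move=> x y; split; exact: der_cst.
- by move=> x y; rewrite addr0 lexx.
- by move=> z; exact: cvg_cst.
Qed.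

Lemma strip_subharmonicD w1 d1 w2 d2 (e : R) : 0 <= e ->
  strip_subharmonic w1 d1 -> strip_subharmonic w2 d2 ->
  strip_subharmonic (fun x y => w1 x y + e * w2 x y) (d1 + e * d2).
Proof.
move=> e0 [wx [wxx [wy [wyy [B [L [H1 H2 H3 [H4 H5 H6 [H7 H8 <-]]]]]]]]]
          [vx [vxx [vy [vyy [C [M [K1 K2 K3 [K4 K5 K6 [K7 K8 <-]]]]]]]]].
exists (fun x y => wx x y + e * vx x y), (fun x y => wxx x y + e * vxx x y),
  (fun x y => wy x y + e * vy x y), (fun x y => wyy x y + e * vyy x y),
  (B + e * C), (L + e * M).
have bnd (f g : R) (F G : R) : `|f| <= F -> `|g| <= G -> `|f + e * g| <= F + e * G.
  move=> fF gG; apply: le_trans (ler_normD _ _) _; apply: lerD => //.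
  by rewrite normrM ger0_norm// ler_wpM2l.
split => //.
- move=> x y; have [h1 h2 h3 h4] := H1 x y; have [g1 g2 g3 g4] := K1 x y.
  by split; apply: derD => //; exact: derZ.
- by move=> x y; have := H2 x y; have := mulr_ge0 e0 (K2 x y); lra.
- move=> z; apply: cvgD; first exact: H3.
  by apply: cvgM; [exact: cvg_cst|exact: K3].
- split; try by move=> x y h; apply: bnd; [auto|auto].
  split => //.
  + by move=> y; have := H7 y; have := mulr_ge0_le0 e0 (K7 y); lra.
  + by rewrite H8 K8 mulr0 addr0.
Qed.

(** Many bounds can thus be added as functions and integrated once. *)
Lemma strip_subharmonic_sum n (e : 'I_n -> R) (w : 'I_n -> R -> R -> R) (d : 'I_n -> R) :
  (forall i, 0 <= e i) -> (forall i, strip_subharmonic (w i) (d i)) ->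
  strip_subharmonic (fun x y => \sum_(i < n) e i * w i x y) (\sum_(i < n) e i * d i).
Proof.
elim: n e w d => [|n IH] e w d e0 wd.
  rewrite big_ord0 (_ : (fun _ _ => _) = fun _ _ => 0); first exact: strip_subharmonic0.
  by apply/funext => x; apply/funext => y; rewrite big_ord0.
rewrite big_ord_recr (_ : (fun _ _ => _) = fun x y =>
  (\sum_(i < n) e (widen_ord (leqnSn n) i) * w (widen_ord (leqnSn n) i) x y)
  + e ord_max * w ord_max x y).
  by apply: strip_subharmonicD => //; apply: IH.
by apply/funext => x; apply/funext => y; rewrite big_ord_recr.
Qed.

End StripSubharmonic.

Section ExponentialSums.
Context {R : realType}.
Implicit Types (x y : R) (s : seq (R[i] * R)).

(** [esR] and [esI] are the real and imaginary parts of [\sum c * exp (al * (x + i y))] over the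
    pairs [(c, al)] of [s], kept real for the sake of real calculus. [es_deriv] is the complex
    derivative, and the four derivative lemmas below contain the Cauchy-Riemann equations. *)
Definition esR s x y : R := \sum_(p <- s) expR (p.2 * x) *
  (complex.Re p.1 * cos (p.2 * y) - complex.Im p.1 * sin (p.2 * y)).
Definition esI s x y : R := \sum_(p <- s) expR (p.2 * x) *
  (complex.Re p.1 * sin (p.2 * y) + complex.Im p.1 * cos (p.2 * y)).
Definition es_deriv s : seq (R[i] * R) :=
  [seq ((p.2 * complex.Re p.1) +i* (p.2 * complex.Im p.1), p.2) | p <- s].

Let der_lin (al x : R) : is_derive x 1 (fun z => al * z) al.
Proof. by apply: (is_derive_eq (derZ al (der_id x))); rewrite mulr1. Qed.

Let der_sum_seq s (F : R[i] * R -> R -> R) (dF : R[i] * R -> R) (x : R) :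
  (forall p, is_derive x 1 (F p) (dF p)) ->
  is_derive x 1 (fun z => \sum_(p <- s) F p z) (\sum_(p <- s) dF p).
Proof.
move=> H; elim: s => [|p s IH].
  rewrite big_nil (_ : (fun _ => _) = fun=> 0); first exact: der_cst.
  by apply/funext => z; rewrite big_nil.
rewrite big_cons (_ : (fun _ => _) = fun z => F p z + \sum_(p <- s) F p z).
  exact: derD.
by apply/funext => z; rewrite big_cons.
Qed.

Lemma esR_derx s x y : is_derive x 1 (esR s ^~ y) (esR (es_deriv s) x y).
Proof.
rewrite {2}/esR big_map; apply: der_sum_seq => -[c al] /=.
apply: (is_derive_eq (derM (der_comp (is_derive_expR _) (der_lin al x))
  (der_cst _ x))).
by ring.
Qed.

Lemma esI_derx s x y : is_derive x 1 (esI s ^~ y) (esI (es_deriv s) x y).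
Proof.
rewrite {2}/esI big_map; apply: der_sum_seq => -[c al] /=.
apply: (is_derive_eq (derM (der_comp (is_derive_expR _) (der_lin al x))
  (der_cst _ x))).
by ring.
Qed.

Lemma esR_dery s x y : is_derive y 1 (esR s x) (- esI (es_deriv s) x y).
Proof.
rewrite /esI big_map -sumrN; apply: der_sum_seq => -[c al] /=.
apply: (is_derive_eq (derZ _ (derB
  (derZ _ (der_comp (is_derive_cos _) (der_lin al y)))
  (derZ _ (der_comp (is_derive_sin _) (der_lin al y)))))).
by ring.
Qed.

Lemma esI_dery s x y : is_derive y 1 (esI s x) (esR (es_deriv s) x y).
Proof.
rewrite /esR big_map; apply: der_sum_seq => -[c al] /=.
apply: (is_derive_eq (derZ _ (derD
  (derZ _ (der_comp (is_derive_sin _) (der_lin al y)))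
  (derZ _ (der_comp (is_derive_cos _) (der_lin al y)))))).
by ring.
Qed.

Lemma es_bound s : exists2 K, 0 <= K & forall x y, 0 <= x <= 1 ->
  `|esR s x y| <= K /\ `|esI s x y| <= K.
Proof.
elim: s => [|[c al] s [K K0 IH]].
  by exists 0 => // x y _; rewrite /esR /esI !big_nil normr0.
exists (expR `|al| * (`|complex.Re c| + `|complex.Im c|) + K) => [|x y x01].
  by rewrite addr_ge0// mulr_ge0 ?expR_ge0// addr_ge0.
have [h1 h2] := IH x y x01; rewrite /esR /esI !big_cons /= -/(esR s x y) -/(esI s x y).
have e1 : expR (al * x) <= expR `|al|.
  rewrite ler_expR; apply: le_trans (ler_norm _) _; case/andP: x01 => x0 x1.
  by rewrite normrM (ger0_norm x0) ler_piMr.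
have c1 : `|cos (al * y)| <= 1 by rewrite ler_norml cos_geN1 cos_le1.
have s1 : `|sin (al * y)| <= 1 by rewrite ler_norml sin_geN1 sin_le1.
have key (p q u v : R) : `|u| <= 1 -> `|v| <= 1 ->
    `|expR (al * x) * (p * u + q * v)| <= expR `|al| * (`|p| + `|q|).
  move=> u1 v1; rewrite normrM (ger0_norm (expR_ge0 _)).
  rewrite ler_pM ?expR_ge0//; apply: le_trans (ler_normD _ _) _.
  by rewrite !normrM lerD// ler_piMr.
by split; (apply: le_trans (ler_normD _ _) _; apply: lerD => //);
  [rewrite -mulrN; apply: key; rewrite ?normrN|exact: key].
Qed.

Lemma es_continuous s : continuous (fun z : R * R => esR s z.1 z.2) /\
  continuous (fun z : R * R => esI s z.1 z.2).
Proof.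
have ce (al : R) (z : R * R) : expR (al * z'.1) @[z' --> z] --> expR (al * z.1).
  by apply: continuous_cvg; [exact: continuous_expR|apply: cvgM; [exact: cvg_cst|exact: cvg_fst]].
have cc (al : R) (z : R * R) : cos (al * z'.2) @[z' --> z] --> cos (al * z.2).
  by apply: continuous_cvg; [exact: continuous_cos|apply: cvgM; [exact: cvg_cst|exact: cvg_snd]].
have cs (al : R) (z : R * R) : sin (al * z'.2) @[z' --> z] --> sin (al * z.2).
  by apply: continuous_cvg; [exact: continuous_sin|apply: cvgM; [exact: cvg_cst|exact: cvg_snd]].
split=> z; (apply: cvg_big => [|p _]; first exact: add_continuous);
  (apply: cvgM; first exact: ce).
- by apply: cvgB; (apply: cvgM; first exact: cvg_cst); [exact: cc|exact: cs].
- by apply: cvgD; (apply: cvgM; first exact: cvg_cst); [exact: cs|exact: cc].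
Qed.

(** With [h = esR + i esI] the Laplacian is [2 k |h'|^2 / (|h|^2 + k)^2], which is nonnegative and
    harmless at zeros of [h]. Subtracting [ln (1 + k) / 2] brings the value at the origin, where
    [h = 1], back to 0. *)
Lemma es_strip_subharmonic s (k : R) : 0 < k ->
  esR s 0 0 = 1 -> esI s 0 0 = 0 ->
  (forall y, esR s 0 y ^+ 2 + esI s 0 y ^+ 2 <= 1) ->
  strip_subharmonic (fun x y =>
      2^-1 * ln (esR s x y * esR s x y + esI s x y * esI s x y + k) - 2^-1 * ln (1 + k))
    (esR (es_deriv s) 0 0 / (1 + k)).
Proof.
move=> k0 s1 s0 sle.
pose a := esR s; pose b := esI s; pose c := esR (es_deriv s); pose d := esI (es_deriv s).
pose e := esR (es_deriv (es_deriv s)); pose f := esI (es_deriv (es_deriv s)).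
pose N x y := a x y * a x y + b x y * b x y + k.
have Nk x y : k <= N x y by rewrite lerDr addr_ge0// -expr2 sqr_ge0.
have N0 x y : 0 < N x y by exact: lt_le_trans (Nk x y).
have Nn0 x y : N x y != 0 by rewrite gt_eqF.
have [K K0 sK] := es_bound s; have [K' K'0 s'K] := es_bound (es_deriv s).
exists (fun x y => (a x y * c x y + b x y * d x y) / N x y),
  (fun x y => ((c x y * c x y + a x y * e x y + (d x y * d x y + b x y * f x y)) * N x y
     - 2 * (a x y * c x y + b x y * d x y) ^+ 2) / N x y ^+ 2),
  (fun x y => (b x y * c x y - a x y * d x y) / N x y),
  (fun x y => ((c x y * c x y - b x y * f x y - (- d x y * d x y + a x y * e x y)) * N x y
     - 2 * (b x y * c x y - a x y * d x y) ^+ 2) / N x y ^+ 2),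
  (`|ln k| + `|ln (K * K + K * K + k)| + `|ln (1 + k)|), ((K * K' + K * K') / k).
have boundN (u v : R) x y : 0 <= x <= 1 -> `|u| <= K * K' -> `|v| <= K * K' ->
    `|(u + v) / N x y| <= (K * K' + K * K') / k.
  move=> x01 uK vK; rewrite normrM normfV (gtr0_norm (N0 x y)).
  apply: ler_pM => //; first by rewrite invr_ge0 ltW.
    by apply: le_trans (ler_normD _ _) _; exact: lerD.
  by rewrite lef_pV2 ?posrE.
split.
- move=> x y.
  have dNx : is_derive x 1 (N ^~ y) (2 * (a x y * c x y + b x y * d x y)).
    apply: (is_derive_eq (derD (derD (derM (esR_derx s x y) (esR_derx s x y))
      (derM (esI_derx s x y) (esI_derx s x y))) (der_cst k x))).
    by rewrite /a /b /c /d; ring.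
  have dNy : is_derive y 1 (N x) (2 * (b x y * c x y - a x y * d x y)).
    apply: (is_derive_eq (derD (derD (derM (esR_dery s x y) (esR_dery s x y))
      (derM (esI_dery s x y) (esI_dery s x y))) (der_cst k y))).
    by rewrite /a /b /c /d; ring.
  split.
  + have D := derB (derZ 2^-1 (@der_comp _ (@ln R) (N^~ y) x _ _ (is_derive1_ln (N0 x y)) dNx))
      (der_cst (2^-1 * ln (1 + k)) x).
    apply: (is_derive_eq D).
    by field; exact: Nn0.
  + apply: (is_derive_eq (derM (derD (derM (esR_derx s x y) (esR_derx (es_deriv s) x y))
      (derM (esI_derx s x y) (esI_derx (es_deriv s) x y))) (derV dNx (Nn0 x y)))).
    rewrite -/a -/b -/c -/d -/e -/f; field; exact: Nn0.
  + have D := derB (derZ 2^-1 (@der_comp _ (@ln R) (N x) y _ _ (is_derive1_ln (N0 x y)) dNy))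
      (der_cst (2^-1 * ln (1 + k)) y).
    apply: (is_derive_eq D).
    by field; exact: Nn0.
  + apply: (is_derive_eq (derM (derB (derM (esI_dery s x y) (esR_dery (es_deriv s) x y))
      (derM (esR_dery s x y) (esI_dery (es_deriv s) x y))) (derV dNy (Nn0 x y)))).
    rewrite -/a -/b -/c -/d -/e -/f; field; exact: Nn0.
- move=> x y.
  rewrite -mulrDl divr_ge0 ?sqr_ge0//.
  (* The second derivatives of the sum cancel by the Cauchy-Riemann equations, and the two squares
     add up to [(A ^+ 2 + B ^+ 2) * (C ^+ 2 + D ^+ 2)]. *)
  have -> : forall A B C D E F : R, (C * C + A * E + (D * D + B * F)) * (A * A + B * B + k)
     - 2 * (A * C + B * D) ^+ 2 + ((C * C - B * F - (- D * D + A * E)) * (A * A + B * B + k)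
     - 2 * (B * C - A * D) ^+ 2) = 2 * k * (C ^+ 2 + D ^+ 2).
    by move=> *; ring.
  by rewrite !mulr_ge0 ?addr_ge0 ?sqr_ge0// ltW.
- have [cR cI] := es_continuous s.
  move=> z; apply: cvgB; last exact: cvg_cst.
  apply: cvgM; first exact: cvg_cst.
  apply: continuous_cvg; first exact: continuous_ln (N0 z.1 z.2).
  apply: cvgD; last exact: cvg_cst.
  by apply: cvgD; apply: cvgM; [exact: cR|exact: cR|exact: cI|exact: cI].
- split.
  + move=> x y x01; have [aK bK] := sK x y x01.
    have NK : N x y <= K * K + K * K + k.
      have sq (u : R) : `|u| <= K -> u * u <= K * K.
        by move=> uK; rewrite -[u * u]ger0_norm -?expr2 ?sqr_ge0// normrX !expr2 ler_pM.
      by rewrite lerD2r lerD// sq.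
    have M0 : 0 < K * K + K * K + k by exact: lt_le_trans NK.
    have l1 : ln k <= ln (N x y) by rewrite ler_ln ?posrE.
    have l2 : ln (N x y) <= ln (K * K + K * K + k) by rewrite ler_ln ?posrE.
    have := ler_norm (ln (K * K + K * K + k)); have := ler_norm (- ln k).
    have := ler_norm (- ln (1 + k)); have := ler_norm (ln (1 + k)); rewrite !normrN.
    rewrite ler_norml -/a -/b -/(N x y).
    have := normr_ge0 (ln k); have := normr_ge0 (ln (K * K + K * K + k)).
    have := normr_ge0 (ln (1 + k)).
    move: (ln _) (ln _) (ln _) (ln _) l1 l2 => A B C D *; apply/andP; split; lra.
  + move=> x y x01; have [aK bK] := sK x y x01; have [cK dK] := s'K x y x01.
    by apply: boundN => //; rewrite normrM ler_pM.
  + move=> x y x01; have [aK bK] := sK x y x01; have [cK dK] := s'K x y x01.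
    by apply: boundN => //; rewrite ?normrN normrM ler_pM.
  + split.
    * move=> y; rewrite subr_le0 ler_pM2l// ler_ln ?posrE; first last.
      - by rewrite addr_gt0.
      - exact: (N0 0 y).
      by rewrite lerD2r -!expr2.
    * by rewrite s1 s0 mulr0 mulr1 addr0 subrr.
    * by rewrite /N /a /b s1 s0 !mul0r mul1r mulr1 !addr0.
Qed.

End ExponentialSums.

Section ComplexExponentialSums.
Context {R : realType}.
Local Notation C := R[i].
Implicit Types (x y : R) (s : seq (C * R)).

Lemma cexpD (z w : C) : cexp (z + w) = cexp z * cexp w.
Proof.
case: z w => [a b] [c d]; rewrite /cexp /= expRD cosD sinD.
by apply/eqP; rewrite eq_complex /=; apply/andP; split; apply/eqP; ring.
Qed.

Lemma cexp0 : cexp 0 = 1 :> C.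
Proof.
rewrite /cexp /= expR0 cos0 sin0; apply/eqP.
by rewrite eq_complex /= !mulr0 !mul0r !mulr1 subr0 addr0 !eqxx.
Qed.

Definition es s x y : C := \sum_(p <- s) p.1 * cexp ((x +i* y) * p.2%:C).

Lemma Re_es s x y : complex.Re (es s x y) = esR s x y.
Proof.
rewrite /es /esR; elim: s => [|[c al] s IH]; first by rewrite !big_nil.
rewrite !big_cons -IH /=; case: c => u v; rewrite /cexp /=.
case: (\sum_(j <- s) _) => A B /=.
rewrite !mul0r !mulr0 !subr0 !addr0 ?add0r [x * al]mulrC [y * al]mulrC.
by ring.
Qed.

Lemma Im_es s x y : complex.Im (es s x y) = esI s x y.
Proof.
rewrite /es /esI; elim: s => [|[c al] s IH]; first by rewrite !big_nil.
rewrite !big_cons -IH /=; case: c => u v; rewrite /cexp /=.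
case: (\sum_(j <- s) _) => A B /=.
rewrite !mul0r !mulr0 !subr0 !addr0 ?add0r [x * al]mulrC [y * al]mulrC.
by ring.
Qed.

(* [f] is an exponential sum in [x + i y] with value [f0] and derivative [f1]
   at [0]. *)
Definition is_es (f : R -> R -> C) (f0 f1 : C) :=
  exists s, [/\ forall x y, f x y = es s x y, \sum_(p <- s) p.1 = f0 &
    \sum_(p <- s) p.2%:C * p.1 = f1].

Lemma is_es_ext f g f0 f1 : (forall x y, f x y = g x y) -> is_es f f0 f1 -> is_es g f0 f1.
Proof. by move=> fg [s [H1 H2 H3]]; exists s; split => // x y; rewrite -fg. Qed.

Lemma is_es_cst c : is_es (fun _ _ => c) c 0.
Proof.
exists [:: (c, 0)]; rewrite /es; split => [x y||]; rewrite big_seq1 //=.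
  by rewrite rmorph0 mulr0 cexp0 mulr1.
by rewrite rmorph0 mul0r.
Qed.

Lemma is_es_exp (al : R) : is_es (fun x y => cexp ((x +i* y) * al%:C)) 1 al%:C.
Proof.
by exists [:: (1, al)]; rewrite /es; split => [x y||]; rewrite big_seq1 ?mul1r ?mulr1.
Qed.

Lemma is_esD f f0 f1 g g0 g1 : is_es f f0 f1 -> is_es g g0 g1 ->
  is_es (fun x y => f x y + g x y) (f0 + g0) (f1 + g1).
Proof.
move=> [s [H1 <- <-]] [t [K1 <- <-]]; exists (s ++ t); rewrite /es.
by split => [x y||]; rewrite big_cat //= H1 K1.
Qed.

Lemma is_esM f f0 f1 g g0 g1 : is_es f f0 f1 -> is_es g g0 g1 ->
  is_es (fun x y => f x y * g x y) (f0 * g0) (f1 * g0 + f0 * g1).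
Proof.
move=> [s [H1 <- <-]] [t [K1 <- <-]].
exists [seq (p.1 * q.1, p.2 + q.2) | p <- s, q <- t]; rewrite /es.
split => [x y||]; rewrite big_allpairs_dep ?H1 ?K1 /es /=.
- rewrite mulr_suml; apply: eq_bigr => p _; rewrite mulr_sumr; apply: eq_bigr => q _.
  by rewrite rmorphD mulrDr cexpD; ring.
- by rewrite mulr_suml; apply: eq_bigr => p _; rewrite mulr_sumr.
- rewrite !mulr_suml -big_split /=; apply: eq_bigr => p _.
  rewrite !mulr_sumr -big_split /=; apply: eq_bigr => q _.
  by rewrite rmorphD; ring.
Qed.

Lemma is_es_sum (T : Type) (r : seq T) (P : pred T) (f : T -> R -> R -> C) (f0 f1 : T -> C) :
  (forall i, is_es (f i) (f0 i) (f1 i)) ->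
  is_es (fun x y => \sum_(i <- r | P i) f i x y) (\sum_(i <- r | P i) f0 i)
    (\sum_(i <- r | P i) f1 i).
Proof.
move=> H; elim: r => [|i r IH].
  by rewrite !big_nil; apply: is_es_ext (is_es_cst 0) => x y; rewrite big_nil.
rewrite !big_cons; case: ifP => Pi.
  by apply: is_es_ext (is_esD (H i) IH) => x y; rewrite big_cons Pi.
by apply: is_es_ext IH => x y; rewrite big_cons Pi.
Qed.

Lemma is_es_prod n (f : 'I_n -> R -> R -> C) (f0 f1 : 'I_n -> C) :
  (forall i, is_es (f i) (f0 i) (f1 i)) ->
  is_es (fun x y => \prod_(i < n) f i x y) (\prod_(i < n) f0 i)
    (\sum_(i < n) f1 i * \prod_(j < n | j != i) f0 j).
Proof.
elim: n f f0 f1 => [|n IH] f f0 f1 H.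
  by rewrite !big_ord0; apply: is_es_ext (is_es_cst 1) => x y; rewrite big_ord0.
have := is_esM (H ord0) (IH _ _ _ (fun i => H (lift ord0 i))).
rewrite !big_ord_recl /= => E.
have -> : \sum_(i < n) f1 (lift ord0 i) * \prod_(j < n.+1 | j != lift ord0 i) f0 j =
    f0 ord0 * \sum_(i < n) f1 (lift ord0 i) * \prod_(j < n | j != i) f0 (lift ord0 j).
  rewrite mulr_sumr; apply: eq_bigr => i _; rewrite big_mkcond big_ord_recl /= mulrCA.
  rewrite [in RHS]big_mkcond /=; congr (_ * (_ * _)).
have -> : f1 ord0 * \prod_(j < n.+1 | j != ord0) f0 j =
    f1 ord0 * \prod_(i < n) f0 (lift ord0 i).
  by rewrite big_mkcond big_ord_recl /= mul1r.
by apply: is_es_ext E => x y; rewrite big_ord_recl.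
Qed.

Definition is_esmx m n (A : R -> R -> 'M[C]_(m, n)) (A0 A1 : 'M[C]_(m, n)) :=
  forall i j, is_es (fun x y => A x y i j) (A0 i j) (A1 i j).

Lemma is_esmx_cst m n (A : 'M[C]_(m, n)) : is_esmx (fun _ _ => A) A 0.
Proof. by move=> i j; rewrite mxE; exact: is_es_cst. Qed.

Lemma is_esmxM m n p (A : R -> R -> 'M[C]_(m, n)) A0 A1
    (B : R -> R -> 'M[C]_(n, p)) B0 B1 : is_esmx A A0 A1 -> is_esmx B B0 B1 ->
  is_esmx (fun x y => A x y *m B x y) (A0 *m B0) (A1 *m B0 + A0 *m B1).
Proof.
move=> HA HB i k; rewrite !mxE -big_split /=.
apply: is_es_ext (is_es_sum _ _ (fun j => is_esM (HA i j) (HB j k))) => x y.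
by rewrite mxE.
Qed.

Lemma is_esmx_diag n (al : 'I_n -> R) :
  is_esmx (fun x y => diag_mx (\row_j cexp ((x +i* y) * (al j)%:C))) 1%:M
    (diag_mx (\row_j (al j)%:C)).
Proof.
move=> i j; rewrite !mxE; have [->|ij] := eqVneq i j.
  rewrite mulr1n; apply: is_es_ext (is_es_exp (al j)) => x y.
  by rewrite !mxE eqxx mulr1n.
rewrite mulr0n; apply: is_es_ext (is_es_cst 0) => x y.
by rewrite !mxE (negbTE ij) mulr0n.
Qed.

(** A nontrivial permutation moves at least two indices, so each of its product-rule terms retains a
    vanishing off-diagonal entry of the identity. The identity permutation alone contributes, and
    gives the trace. *)
Lemma is_es_det n (A : R -> R -> 'M[C]_n) (A1 : 'M[C]_n) :
  is_esmx A 1%:M A1 -> is_es (fun x y => \det (A x y)) 1 (\tr A1).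
Proof.
move=> HA.
have H := is_es_sum (index_enum {perm 'I_n}) xpredT (fun s : {perm 'I_n} =>
  is_esM (is_es_cst ((-1) ^+ s)) (is_es_prod (fun i => HA i (s i)))).
have -> : 1 = \sum_s (-1) ^+ (s : {perm 'I_n}) * \prod_i (1%:M : 'M[C]_n) i (s i).
  by rewrite -[LHS](det1 C n).
suff -> : \tr A1 = \sum_(s : {perm 'I_n}) (0 * \prod_(i < n) (1%:M : 'M[C]_n) i (s i) +
    (-1) ^+ s * \sum_(i < n) A1 i (s i) * \prod_(j < n | j != i) (1%:M : 'M[C]_n) j (s j)).
  exact: H.
rewrite (bigD1 1%g) //= [X in _ + X]big1 ?addr0 => [|s s1].
  rewrite odd_perm1 mul0r add0r expr0 mul1r.
  apply: eq_bigr => i _; rewrite perm1 big1 ?mulr1// => j _.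
  by rewrite perm1 mxE eqxx.
rewrite mul0r add0r big1 ?mulr0// => i _.
have [j /andP[ji sj]] : exists j, (j != i) && (s j != j).
  apply/existsP; move: s1.
  apply: contraNT; rewrite negb_exists => /forallP h.
  have hj j : j != i -> s j = j.
    by move=> ji; have := h j; rewrite ji /= negbK => /eqP.
  apply/eqP/permP => j; rewrite perm1.
  have [->|] := eqVneq j i; last exact: hj.
  apply/eqP; apply: contraT => si; have := hj _ si => /perm_inj e.
  by rewrite e eqxx in si.
by rewrite (bigD1 j) //= mxE eq_sym (negbTE sj) mul0r mulr0.
Qed.

End ComplexExponentialSums.

(** * Minors and compressions *)

Section CauchyBinet.
Context {K : comNzRingType} {k d : nat}.
Implicit Types (A : 'M[K]_(k, d)) (B : 'M[K]_(d, k)) (f : {ffun 'I_k -> 'I_d}).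

Lemma det_mulmx_expand A B :
  \det (A *m B) = \sum_(f : {ffun 'I_k -> 'I_d})
    (\prod_i A i (f i)) * \det (rowsub f B).
Proof.
transitivity (\sum_(s : {perm 'I_k}) \sum_(f : {ffun 'I_k -> 'I_d})
    (-1) ^+ s * \prod_i (A i (f i) * B (f i) (s i))).
  apply: eq_bigr => s _; rewrite -mulr_sumr; congr (_ * _).
  rewrite -(bigA_distr_bigA (fun i j => A i j * B j (s i))).
  by apply: eq_bigr => i _; rewrite mxE.
rewrite exchange_big; apply: eq_bigr => f _; rewrite /determinant mulr_sumr.
apply: eq_bigr => s _; rewrite big_split /= mulrCA; congr (_ * (_ * _)).
by apply: eq_bigr => i _; rewrite mxE.
Qed.

(* Summing over all maps instead of over the [k]-subsets counts every minor
   [k!] times. *)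
Lemma cauchy_binet A B :
  \sum_(f : {ffun 'I_k -> 'I_d}) \det (colsub f A) * \det (rowsub f B) =
  \det (A *m B) *+ k`!.
Proof.
transitivity (\sum_(s : {perm 'I_k}) \sum_(f : {ffun 'I_k -> 'I_d})
    (-1) ^+ s * (\prod_i A i (f (s i)) * \det (rowsub f B))).
  rewrite exchange_big; apply: eq_bigr => f _; rewrite mulr_suml.
  apply: eq_bigr => s _; rewrite mulrA; congr (_ * _ * _).
  by apply: eq_bigr => i _; rewrite mxE.
transitivity (\sum_(s : {perm 'I_k}) \det (A *m B)); last first.
  by rewrite sumr_const card_Sn.
apply: eq_bigr => s _; rewrite det_mulmx_expand.
(* Replacing [f] by [f \o s^-1] moves [s] into the second minor, as a row permutation whose sign
   cancels [(-1) ^+ s]. *)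
pose h f : {ffun 'I_k -> 'I_d} := [ffun i => f ((s^-1)%g i)].
have hK : bijective h.
  exists (fun f : {ffun 'I_k -> 'I_d} => [ffun i => f (s i)]) => f;
  by apply/ffunP => i; rewrite !ffunE ?permK ?permKV.
rewrite (reindex h) /=; last exact: onW_bij.
apply: eq_bigr => f _.
have -> : \prod_i A i (h f (s i)) = \prod_i A i (f i).
  by apply: eq_bigr => i _; rewrite ffunE permK.
rewrite mulrCA; congr (_ * _).
have -> : rowsub (h f) B = row_perm (s^-1)%g (rowsub f B).
  by apply/matrixP => i j; rewrite !mxE ffunE.
rewrite row_permE det_mulmx det_perm odd_permV mulrA -signr_addb addbb mul1r //.
Qed.

Lemma det_rowsub_noninj f B : ~~ injectiveb f -> \det (rowsub f B) = 0.
Proof.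
move=> /injectivePn [i [j ij fij]]; apply: (determinant_alternate ij) => l.
by rewrite !mxE fij.
Qed.

End CauchyBinet.

Section Adjoint.
Context {R : realType}.
Local Notation C := R[i].

Definition adjmx m n (A : 'M[C]_(m, n)) : 'M[C]_(n, m) := map_mx conjc A^T.

Lemma adjmxE m n (A : 'M[C]_(m, n)) i j : adjmx A i j = (A j i)^*.
Proof. by rewrite !mxE. Qed.

Lemma adjmxK m n (A : 'M[C]_(m, n)) : adjmx (adjmx A) = A.
Proof. by apply/matrixP => i j; rewrite !adjmxE conjcK. Qed.

Lemma adjmxM m n p (A : 'M[C]_(m, n)) (B : 'M[C]_(n, p)) :
  adjmx (A *m B) = adjmx B *m adjmx A.
Proof. by rewrite /adjmx trmx_mul map_mxM. Qed.

Lemma adjmx1 n : adjmx (1%:M : 'M[C]_n) = 1%:M.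
Proof. by rewrite /adjmx trmx1 map_mx1. Qed.

Lemma det_adjmx n (A : 'M[C]_n) : \det (adjmx A) = (\det A)^*.
Proof. by rewrite /adjmx det_map_mx det_tr. Qed.

Lemma det_mul_adjmx k d (A : 'M[C]_(k, d)) :
  \det (A *m adjmx A) *+ k`! = \sum_(f : {ffun 'I_k -> 'I_d}) `|\det (colsub f A)| ^+ 2.
Proof.
rewrite -cauchy_binet; apply: eq_bigr => f _.
have -> : rowsub f (adjmx A) = adjmx (colsub f A).
  by apply/matrixP => i j; rewrite !mxE.
by rewrite det_adjmx sqr_normc.
Qed.

(** Lagrange's identity: twice the difference of the two sides is the double sum of the squares
    [(u s * v t - u t * v s) ^+ 2]. *)
Lemma cauchy_schwarz_sum (F : numDomainType) (T : finType) (u v : T -> F) :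
  (forall t, 0 <= u t) -> (forall t, 0 <= v t) ->
  (\sum_t u t * v t) ^+ 2 <= (\sum_t u t ^+ 2) * (\sum_t v t ^+ 2).
Proof.
move=> u0 v0.
have H : 0 <= \sum_s \sum_t (u s * v t - u t * v s) ^+ 2.
  apply: sumr_ge0 => s _; apply: sumr_ge0 => t _; apply: real_exprn_even_ge0 => //.
  by rewrite rpredB// rpredM// ger0_real.
suff E : \sum_s \sum_t (u s * v t - u t * v s) ^+ 2 =
    ((\sum_t u t ^+ 2) * (\sum_t v t ^+ 2) - (\sum_t u t * v t) ^+ 2) *+ 2.
  by rewrite -subr_ge0; rewrite E pmulrn_lge0 in H.
rewrite mulr2n {1}expr2 !mulr_suml -!sumrB.
rewrite [in X in _ = _ + X]expr2.
transitivity (\sum_s \sum_t (u s ^+ 2 * v t ^+ 2 - u s * v s * (u t * v t)) +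
  \sum_s \sum_t (u t ^+ 2 * v s ^+ 2 - u s * v s * (u t * v t))).
  rewrite -big_split; apply: eq_bigr => s _; rewrite -big_split; apply: eq_bigr => t _ /=.
  by ring.
congr (_ + _).
  by apply: eq_bigr => s _; rewrite sumrB -!mulr_sumr.
rewrite [in RHS]mulr_suml -sumrB.
transitivity (\sum_s \sum_t u t ^+ 2 * v s ^+ 2 - \sum_s \sum_t u s * v s * (u t * v t)).
  by rewrite -sumrB; apply: eq_bigr => s _; rewrite sumrB.
rewrite exchange_big /= -sumrB; apply: eq_bigr => s _.
by rewrite -!mulr_sumr.
Qed.

(** Cauchy-Schwarz for the vectors of all [k]-minors of [A] and [B]; the factorials from
    [cauchy_binet] cancel. *)
Lemma det_mulmx_cauchy_schwarz k d (A : 'M[C]_(k, d)) (B : 'M[C]_(d, k)) :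
  `|\det (A *m B)| ^+ 2 <= \det (A *m adjmx A) * \det (adjmx B *m B).
Proof.
have k0 : (0 : C) < k`!%:R by rewrite ltr0n fact_gt0.
have E1 := det_mul_adjmx A; have E2 := det_mul_adjmx (adjmx B).
rewrite adjmxK in E2.
rewrite -(ler_pM2r (exprn_gt0 2 k0)) -exprMn.
rewrite [leRHS](_ : _ = (\det (A *m adjmx A) *+ k`!) * (\det (adjmx B *m B) *+ k`!)); last first.
  by rewrite mulrnAl mulrnAr expr2 mulrA !mulr_natr.
rewrite E1 E2 -[X in _ * X]normr_nat -normrM mulr_natr -cauchy_binet.
apply: le_trans (_ : (\sum_(f : {ffun 'I_k -> 'I_d})
   `|\det (colsub f A)| * `|\det (rowsub f B)|) ^+ 2 <= _).
  rewrite lerXn2r ?nnegrE ?normr_ge0 ?sumr_ge0//.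
  by apply: le_trans (ler_norm_sum _ _ _) _; apply: ler_sum => f _; rewrite normrM.
apply: le_trans (cauchy_schwarz_sum _ _) _ => //.
rewrite le_eqVlt; apply/orP; left; apply/eqP; congr (_ * _).
apply: eq_bigr => f _; have -> : colsub f (adjmx B) = adjmx (rowsub f B).
  by apply/matrixP => i j; rewrite !mxE.
by rewrite det_adjmx normcJ.
Qed.

(** By Cauchy-Binet the determinant is an average of the products [\prod_i mu (f i)], weighted by
    the squared minors of [W]. The normalized weights sum to 1 because the columns of [W] are
    orthonormal, and they vanish unless [f] is injective. *)
Lemma det_compression_diag k d (W : 'M[C]_(d, k)) (mu : 'I_d -> R) (M : R) :
  adjmx W *m W = 1%:M -> (forall s, 0 <= mu s) ->
  (forall f : 'I_k -> 'I_d, injective f -> \prod_i mu (f i) <= M) ->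
  \det (adjmx W *m diag_mx (\row_s (mu s)%:C) *m W) <= M%:C.
Proof.
move=> W1 mu0 HM.
have k0 : (0 : C) < k`!%:R by rewrite ltr0n fact_gt0.
rewrite -(ler_pM2r k0) mulr_natr -cauchy_binet.
have E := det_mul_adjmx (adjmx W); rewrite adjmxK W1 det1 in E.
rewrite E mulr_sumr; apply: ler_sum => f _.
have -> : colsub f (adjmx W *m diag_mx (\row_s (mu s)%:C)) =
   colsub f (adjmx W) *m diag_mx (\row_i (mu (f i))%:C).
  by apply/matrixP => i j; rewrite !mul_mx_diag !mxE.
have colE : colsub f (adjmx W) = adjmx (rowsub f W).
  by apply/matrixP => i j; rewrite !mxE.
rewrite det_mulmx det_diag colE det_adjmx normcJ.
rewrite mulrAC [_^* * _]mulrC -sqr_normc mulrC.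
have [/injectiveP finj|fninj] := boolP (injectiveb f); last first.
  by rewrite det_rowsub_noninj// normr0 expr0n/= !mulr0.
apply: ler_wpM2r; first by rewrite exprn_ge0.
rewrite (eq_bigr (fun i => (mu (f i))%:C)) => [|i _]; last by rewrite mxE.
by rewrite -rmorph_prod lecR; exact: HM.
Qed.

(* Horn's inequality for a compression of [G] to a [k]-dimensional subspace, [mu]
   being the squared singular values of [G]. *)
Lemma det_compression_le k d (V : 'M[C]_(d, k)) (G Q : 'M[C]_d) (mu : 'I_d -> R) (M : R) :
  adjmx V *m V = 1%:M -> adjmx Q *m Q = 1%:M ->
  adjmx G *m G = Q *m diag_mx (\row_s (mu s)%:C) *m adjmx Q ->
  (forall s, 0 <= mu s) ->
  (forall f : 'I_k -> 'I_d, injective f -> \prod_i mu (f i) <= M) ->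
  `|\det (adjmx V *m G *m V)| ^+ 2 <= M%:C.
Proof.
move=> V1 Q1 GE mu0 HM.
(* Splitting between [adjmx V] and [G *m V], the first Gram determinant is 1 and the second is that
   of a compression of [adjmx G *m G]. *)
rewrite -mulmxA; apply: le_trans (det_mulmx_cauchy_schwarz _ _) _.
rewrite adjmxK V1 det1 mul1r adjmxM mulmxA -[adjmx V *m _ *m G]mulmxA GE.
rewrite !mulmxA -[adjmx V *m Q]adjmxK adjmxM adjmxK -!mulmxA mulmxA.
apply: (@det_compression_diag k d (adjmx Q *m V)) => //.
by rewrite adjmxM adjmxK mulmxA -[adjmx V *m Q *m _]mulmxA (mulmx1C Q1) mulmx1.
Qed.

End Adjoint.

(** * Spectral decompositions of tensors *)

Section Spectral.
Context {R : realType}.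
Local Notation C := R[i].

Definition rdiag d (l : 'I_d -> R) : 'M[C]_d := diag_mx (\row_s (l s)%:C).

Lemma adjmx_rdiag d (l : 'I_d -> R) : adjmx (rdiag l) = rdiag l.
Proof.
apply/matrixP => i j; rewrite adjmxE !mxE eq_sym.
by have [->|] := eqVneq i j; rewrite ?mulr1n ?mulr0n ?conjc_real ?conjc0.
Qed.

Lemma hermitian_spectral d (A : 'M[C]_d) : adjmx A = A ->
  exists (P : 'M[C]_d) (l : 'I_d -> R),
    adjmx P *m P = 1%:M /\ A = P *m rdiag l *m adjmx P.
Proof.
move=> Ah; have An : A \is spectral.normalmx.
  by rewrite qualifE /=; change (A *m adjmx A == adjmx A *m A); rewrite Ah.
have PU := spectral.spectral_unitarymx A; set P := spectral.spectralmx A in PU.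
have PP : P *m adjmx P = 1%:M by move: PU; rewrite qualifE => /eqP.
have PP' := mulmx1C PP.
have Punit : P \in unitmx by case: (mulmx1_unit PP).
have Pinv : invmx P = adjmx P by rewrite -[LHS]mulmx1 -PP mulmxA mulVmx// mul1mx.
move/spectral.orthomx_spectralP: An; rewrite -/P; set D := spectral.spectral_diag A => AE.
have DE : diag_mx D = P *m A *m adjmx P.
  by rewrite AE Pinv !mulmxA PP mul1mx -mulmxA PP mulmx1.
have Dh : adjmx (diag_mx D) = diag_mx D.
  by rewrite DE !adjmxM adjmxK Ah mulmxA.
exists (adjmx P), (fun s => complex.Re (D 0 s)); rewrite adjmxK; split; first exact: PP.
rewrite [LHS]AE Pinv; congr (_ *m _ *m _); congr diag_mx.
apply/rowP => s; rewrite !mxE; have := congr1 (fun M : 'M[C]_d => M s s) Dh.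
rewrite adjmxE !mxE eqxx !mulr1n /=; case: (D 0 s) => a b [] /eqP.
by rewrite -subr_eq0 -opprD oppr_eq0 -mulr2n mulrn_eq0 /= => /eqP ->.
Qed.

Lemma char_poly_diag d (D : 'rV[C]_d) :
  char_poly (diag_mx D) = \prod_s ('X - (D 0 s)%:P).
Proof.
rewrite /char_poly /char_poly_mx.
have -> : 'X%:M - map_mx polyC (diag_mx D) = diag_mx (\row_s ('X - (D 0 s)%:P)).
  apply/matrixP => i j; rewrite !mxE; have [->|] := eqVneq i j.
    by rewrite !mulr1n.
  by rewrite !mulr0n subr0.
by rewrite det_diag; apply: eq_bigr => s _; rewrite mxE.
Qed.

Lemma char_poly_conj d (P D : 'M[C]_d) : adjmx P *m P = 1%:M ->
  char_poly (P *m D *m adjmx P) = char_poly D.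
Proof.
move=> P1; have P1' := mulmx1C P1; rewrite /char_poly /char_poly_mx.
have -> : 'X%:M - map_mx polyC (P *m D *m adjmx P) =
    map_mx polyC P *m ('X%:M - map_mx polyC D) *m map_mx polyC (adjmx P).
  rewrite mulmxBr mulmxBl -!map_mxM /=; congr (_ - _).
  by rewrite scalar_mxC -mulmxA -map_mxM P1' map_mx1 mulmx1.
by rewrite !det_mulmx mulrAC -det_mulmx -map_mxM P1' map_mx1 det1 mul1r.
Qed.

(** The characteristic polynomial determines the eigenvalues as a multiset; this removes the
    dependence on the choice made by [full_decomp]. *)
Lemma rdiag_perm d (P Q : 'M[C]_d) (l m : 'I_d -> R) :
  adjmx P *m P = 1%:M -> adjmx Q *m Q = 1%:M ->
  P *m rdiag l *m adjmx P = Q *m rdiag m *m adjmx Q ->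
  perm_eq (codom l) (codom m).
Proof.
move=> P1 Q1 /(congr1 char_poly); rewrite !char_poly_conj// !char_poly_diag => E.
apply: (@perm_map_inj _ _ (real_complex R)); first by move=> a b [].
have H (l' : 'I_d -> R) : \prod_s ('X - ((\row_s (l' s)%:C) 0 s)%:P) =
    \prod_(z <- map (real_complex R) (codom l')) ('X - z%:P).
  by rewrite big_map big_image /=; apply: eq_bigr => s _; rewrite mxE.
by rewrite !H in E; exact: prod_XsubC_eq.
Qed.

End Spectral.

Section TensorMatrix.
Context {R : realType} {N : nat} {I : 'I_N -> nat}.
Local Notation C := R[i].
Local Notation d := #|mindex I|.
Implicit Types (X Y : tensor R I).

Definition tmx X : 'M[C]_d := \matrix_(i, j) X (enum_val i, enum_val j).

Definition vmx r (U : 'I_r -> vec R I) : 'M[C]_(d, r) := \matrix_(i, s) U s (enum_val i).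

Lemma tmx_inj : injective tmx.
Proof.
move=> X Y /matrixP H; apply/ffunP => -[i j].
by have := H (enum_rank i) (enum_rank j); rewrite !mxE !enum_rankK.
Qed.

Lemma sum_enum_val (F : mindex I -> C) : \sum_j F j = \sum_(i < d) F (enum_val i).
Proof. by apply: reindex; apply: onW_bij; exact: enum_val_bij. Qed.

Lemma tmxM X Y : tmx (tmul X Y) = tmx X *m tmx Y.
Proof.
apply/matrixP => i j; rewrite !mxE ffunE /= sum_enum_val.
by apply: eq_bigr => l _; rewrite !mxE.
Qed.

Lemma tmx1 : tmx (tone R I) = 1%:M.
Proof. by apply/matrixP => i j; rewrite !mxE ffunE /= (inj_eq enum_val_inj). Qed.

Lemma tmx_adj X : tmx (tadj X) = adjmx (tmx X).
Proof. by apply/matrixP => i j; rewrite !mxE ffunE. Qed.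

Lemma tmx_sum n (A : 'I_n -> tensor R I) : tmx (\sum_i A i) = \sum_i tmx (A i).
Proof.
apply/matrixP => i j; rewrite summxE mxE sum_ffunE.
by apply: eq_bigr => l _; rewrite mxE.
Qed.

Lemma tmx_outer r (c : 'I_r -> C) (U : 'I_r -> vec R I) :
  tmx (outer_sum c U) = vmx U *m diag_mx (\row_s c s) *m adjmx (vmx U).
Proof.
apply/matrixP => i j; rewrite !mxE ffunE /=; apply: eq_bigr => s _.
by rewrite mul_mx_diag !mxE mulrA [_ * c s]mulrC.
Qed.

Lemma vmx_gram r (U : 'I_r -> vec R I) s t :
  (adjmx (vmx U) *m vmx U) s t = inner (U s) (U t).
Proof. by rewrite mxE /inner sum_enum_val; apply: eq_bigr => i _; rewrite !mxE. Qed.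

Lemma herm_decompP X (l : 'I_d -> R) (U : 'I_d -> vec R I) :
  herm_decomp X l U <->
  tmx X = vmx U *m rdiag l *m adjmx (vmx U) /\ adjmx (vmx U) *m vmx U = 1%:M.
Proof.
split=> [[-> H]|[H1 H2]].
  by rewrite tmx_outer; split => //; apply/matrixP => s t; rewrite vmx_gram H mxE.
split; first by apply: tmx_inj; rewrite tmx_outer.
by move=> s t; rewrite -vmx_gram H2 mxE.
Qed.

Lemma vmx_of_matrix (P : 'M[C]_d) : exists U : {ffun 'I_d -> vec R I}, vmx U = P.
Proof.
exists [ffun s => [ffun t => P (enum_rank t) s]].
by apply/matrixP => i s; rewrite mxE !ffunE enum_valK.
Qed.

Lemma full_decomp_of X (l : 'I_d -> R) (P : 'M[C]_d) :
  tmx X = P *m rdiag l *m adjmx P -> adjmx P *m P = 1%:M ->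
  herm_decomp X (full_decomp X).1 (full_decomp X).2.
Proof.
move=> XE P1; have [U UP] := vmx_of_matrix P.
rewrite /full_decomp; case: xgetP => [_ _ /=//|/(_ ([ffun s => l s], U)) []] /=.
apply/herm_decompP; rewrite UP; split => //.
by rewrite XE; congr (_ *m diag_mx _ *m _); apply/rowP => s; rewrite !mxE ffunE.
Qed.

Lemma hermitian_full_decomp X : Defs.hermitian X ->
  herm_decomp X (full_decomp X).1 (full_decomp X).2.
Proof.
move=> Xh; have [|P [l [P1 XE]]] := @hermitian_spectral _ _ (tmx X).
  by rewrite -tmx_adj Xh.
exact: full_decomp_of XE P1.
Qed.

Lemma full_decomp_perm X (l : 'I_d -> R) (P : 'M[C]_d) :
  tmx X = P *m rdiag l *m adjmx P -> adjmx P *m P = 1%:M ->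
  perm_eq (codom (full_decomp X).1) (codom l).
Proof.
move=> XE P1; have /herm_decompP [E1 E2] := full_decomp_of XE P1.
by apply: (rdiag_perm E2 P1); rewrite -E1.
Qed.

Lemma tmx_tfunr (f : R -> R) X :
  tmx (tfunr f X) = vmx (full_decomp X).2 *m
    rdiag (fun s => f ((full_decomp X).1 s)) *m adjmx (vmx (full_decomp X).2).
Proof. exact: tmx_outer. Qed.

Lemma rdiagM (l m : 'I_d -> R) : rdiag l *m rdiag m = rdiag (fun s => l s * m s).
Proof.
apply/matrixP => i j; rewrite mul_diag_mx !mxE.
by have [->|] := eqVneq i j; rewrite ?mulr1n ?mulr0n ?mulr0// rmorphM.
Qed.

Definition topk k (y : seq R) : R := \sum_(j < k) (sort (fun a b => b <= a) y)`_j.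

Lemma topk_perm k (y z : seq R) : perm_eq y z -> topk k y = topk k z.
Proof.
move=> yz; suff E : sort (fun a b => b <= a) y = sort (fun a b => b <= a) z.
  by rewrite /topk E.
apply/perm_sortP => //.
- by move=> a b; exact: ge_total.
- by move=> a b c h1 h2; exact: le_trans h2 h1.
- by move=> a b /andP[h1 h2]; apply/le_anti; rewrite h1 h2.
Qed.

(** Chosen decompositions of [X], of [Z] and of the square root of [Z] intervene, each known only up
    to a permutation of the eigenvalues, to which [topk] is blind. The square root of a squared
    eigenvalue is its absolute value, whence the sign condition on [f]. *)
Lemma kyfan_tfunr_tmx k (f : R -> R) X (l : 'I_d -> R) (P : 'M[C]_d) :
  tmx X = P *m rdiag l *m adjmx P -> adjmx P *m P = 1%:M ->
  (forall s, 0 <= f (l s)) ->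
  kyfan k (tfunr f X) = topk k [seq f (l s) | s <- enum 'I_d].
Proof.
move=> XE P1 f0; rewrite /kyfan /eigvals -/(topk k _); apply: topk_perm.
have codomE (u : 'I_d -> R) : [seq u s | s <- enum 'I_d] = codom u by [].
have permX := full_decomp_perm XE P1.
set Y := tfunr f X; have YE : tmx Y = _ := tmx_tfunr f X.
have /herm_decompP [_ U1] := full_decomp_of XE P1.
set g := fun s => f _ in YE; set U := vmx _ in YE U1.
set Z := tmul (tadj Y) Y.
have ZE : tmx Z = U *m rdiag (fun s => g s * g s) *m adjmx U.
  rewrite tmxM tmx_adj YE !adjmxM adjmxK adjmx_rdiag -rdiagM !mulmxA.
  by rewrite -[_ *m adjmx U *m U]mulmxA U1 mulmx1.
have permZ := full_decomp_perm ZE U1.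
have /herm_decompP [_ U1'] := full_decomp_of ZE U1.
have permT := full_decomp_perm (tmx_tfunr Num.sqrt Z) U1'.
rewrite codomE; apply: (perm_trans permT).
have -> : codom (fun s => Num.sqrt ((full_decomp Z).1 s)) = map Num.sqrt (codom (full_decomp Z).1).
  by rewrite -map_comp.
apply: (perm_trans (perm_map _ permZ)); rewrite -map_comp.
have -> : map (Num.sqrt \o (fun s => g s * g s)) (enum 'I_d) =
    map (fun x => `|f x|) (codom (full_decomp X).1).
  rewrite -[RHS](map_comp (fun x => `|f x|) (full_decomp X).1).
  by apply: eq_map => s /=; rewrite -expr2 sqrtr_sqr.
apply: (perm_trans (perm_map _ permX)); rewrite -map_comp.
by rewrite (@eq_map _ _ _ (fun s => f (l s)))// => s /=; rewrite ger0_norm.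
Qed.

End TensorMatrix.

(** * Sums of the largest entries and convexity *)

Section TopK.
Context {R : realType}.
Implicit Types (y : seq R) (c : R).

Let desc : rel R := fun a b => b <= a.

Definition srt y : nat -> R := nth 0 (sort desc y).

Lemma srt_mono y i j : (i <= j)%N -> (j < size y)%N -> srt y j <= srt y i.
Proof.
move=> ij jy; have tot : total desc by move=> a b; exact: ge_total.
have tr : transitive desc by move=> a b c h1 h2; exact: le_trans h2 h1.
have := sort_sorted tot y.
move=> /(sorted_leq_nth tr (fun a => lexx a) 0); apply => //;
  by rewrite inE size_sort ?(leq_ltn_trans ij jy).
Qed.

Lemma sum_srt y (F : R -> R) : \sum_(a <- y) F a = \sum_(j < size y) F (srt y j).
Proof.
rewrite -(perm_big _ (permEl (perm_sort desc y))) /= (big_nth 0) size_sort.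
by rewrite big_mkord.
Qed.

Lemma topkE k y : topk k y = \sum_(j < k) srt y j.
Proof. by []. Qed.

(** With the [k]-th largest entry as threshold, the sum of the [k] largest becomes a sum over all
    entries, which can be compared termwise with weighted sums. *)
Lemma topk_threshold k y : (1 <= k <= size y)%N ->
  let c := srt y k.-1 in
  topk k y = k%:R * c + \sum_(a <- y) Num.max (a - c) 0.
Proof.
move=> /andP[k1 ky] c; rewrite sum_srt.
rewrite -(big_mkord xpredT (fun j => Num.max (srt y j - c) 0)) (big_cat_nat (leq0n k) ky)//=.
rewrite [X in _ + (_ + X)]big_nat [X in _ + (_ + X)]big1 ?addr0 => [|j /andP[kj jy]]; last first.
  apply/max_idPr; rewrite subr_le0; apply: srt_mono => //.
  by rewrite (leq_trans (leq_pred _) kj).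
rewrite big_mkord topkE [in RHS](eq_bigr (fun j : 'I_k => srt y j - c)) => [|j _]; last first.
  apply/max_idPl; rewrite subr_ge0; apply: srt_mono.
    by rewrite -ltnS prednK.
  by rewrite (leq_trans _ ky)// prednK.
by rewrite sumrB sumr_const card_ord -[c *+ k]mulr_natl [RHS]addrC subrK.
Qed.

(** Relative to the threshold [c], a weight in [[0, 1]] gains at most [Num.max (y s - c) 0] from
    each entry. *)
Lemma topk_ge (T : finType) k (y w : T -> R) : (1 <= k <= #|T|)%N ->
  (forall s, 0 <= w s <= 1) -> \sum_s w s = k%:R ->
  \sum_s w s * y s <= topk k [seq y s | s <- enum T].
Proof.
move=> kT w01 wk; rewrite topk_threshold; last by rewrite size_map -cardE.
set c := srt _ _; rewrite big_map big_enum /=.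
have -> : \sum_s w s * y s = k%:R * c + \sum_s w s * (y s - c).
  by rewrite -wk mulr_suml -big_split /=; apply: eq_bigr => s _; ring.
rewrite lerD2l; apply: ler_sum => s _; have /andP[w0 w1] := w01 s.
have [yc|/ltW yc] := leP (y s) c.
  by rewrite (max_idPr _) ?subr_le0// mulr_ge0_le0// subr_le0.
by rewrite (max_idPl _) ?subr_ge0// ler_piMl// subr_ge0.
Qed.

(** Optimal weights for [topk_ge] that are a monotone function of the entry itself, as
    [weighted_slopes_mono] requires. Entries equal to the threshold [c] must then share the
    remaining mass evenly, each receiving [th]. *)
Lemma topk_weights k y : (1 <= k <= size y)%N ->
  exists om : R -> R, [/\ {homo om : a b / a <= b}, forall a, 0 <= om a <= 1,
    \sum_(a <- y) om a = k%:R & \sum_(a <- y) om a * a = topk k y].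
Proof.
move=> ky; have /andP[k1 kn] := ky.
rewrite topk_threshold//; set c := srt y k.-1.
pose gt := \sum_(a <- y) ((c < a)%R%:R : R); pose eq := \sum_(a <- y) ((a == c)%:R : R).
have split_sum (F : nat -> R) : \sum_(j < size y) F j =
    \sum_(0 <= j < k) F j + \sum_(k <= j < size y) F j.
  by rewrite -(big_mkord xpredT F) (big_cat_nat (leq0n k) kn).
have kR : k%:R = \sum_(0 <= j < k) (1 : R) by rewrite big_mkord sumr_const card_ord.
have gtk : gt <= k%:R.
  rewrite /gt sum_srt (split_sum (fun j => (c < srt y j)%R%:R)).
  rewrite [X in _ + X]big_nat [X in _ + X]big1 ?addr0.
    by rewrite kR; apply: ler_sum => j _; case: (c < _).
  move=> j /andP[kj jy]; rewrite ltNge srt_mono//.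
  by rewrite (leq_trans (leq_pred _) kj).
have kge : k%:R <= gt + eq.
  rewrite /gt /eq -big_split sum_srt.
  rewrite (split_sum (fun j => (c < srt y j)%R%:R + (srt y j == c)%:R)) /= kR.
  rewrite -[leLHS]addr0; apply: lerD.
    rewrite [leLHS]big_nat [leRHS]big_nat; apply: ler_sum => j /andP[_ jk].
    have : c <= srt y j.
      by apply: srt_mono; [rewrite -ltnS prednK|rewrite prednK].
    by case: ltgtP => //= _ _; rewrite ?addr0 ?add0r.
  by apply: sumr_ge0 => j _; rewrite addr_ge0.
have eq0 : 0 <= eq by apply: sumr_ge0.
have [eqz|eqn] := eqVneq eq 0.
  exfalso; have cy : c \in y.
    by rewrite -(mem_sort desc); apply: mem_nth; rewrite size_sort (leq_trans _ kn)// prednK.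
  have : 0 < eq; last by rewrite eqz ltxx.
  rewrite /eq (big_rem c cy) /= eqxx ltr_pwDl// sumr_ge0//.
have eqp : 0 < eq by rewrite lt_def eqn.
pose th := (k%:R - gt) / eq.
have th0 : 0 <= th by rewrite divr_ge0 ?subr_ge0.
have th1 : th <= 1 by rewrite ler_pdivrMr// mul1r lerBlDl.
pose om a : R := (c < a)%R%:R + th * (a == c)%:R.
have omk : \sum_(a <- y) om a = k%:R.
  by rewrite big_split /= -mulr_sumr -/gt -/eq /th divfK//; ring.
exists om; split => //.
- move=> a b ab; rewrite /om; have [ac|ca|e] := ltgtP a c.
  + by rewrite mulr0 addr0 addr_ge0// mulr_ge0.
  + by rewrite (lt_le_trans ca ab) (gt_eqF (lt_le_trans ca ab)) mulr0.
  + rewrite add0r mulr1; move: ab; rewrite e; case: ltgtP => //= _ _.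
    * by rewrite mulr0 addr0.
    * by rewrite mulr1 add0r.
- move=> a; rewrite /om; have [ac|ca|e] := ltgtP a c.
  + by rewrite mulr0 addr0 lexx ler01.
  + by rewrite mulr0 addr0 lexx ler01.
  + by rewrite add0r mulr1 th0.
- have -> : \sum_(a <- y) om a * a = k%:R * c + \sum_(a <- y) om a * (a - c).
    rewrite -omk mulr_suml -big_split /=; apply: eq_bigr => s _; ring.
  congr (_ + _); apply: eq_bigr => a _; rewrite /om.
  have [ac|ca|->] := ltgtP a c.
  + by rewrite mulr0 addr0 mul0r (max_idPr _)// subr_le0 ltW.
  + by rewrite mulr0 addr0 mul1r (max_idPl _)// subr_ge0 ltW.
  + by rewrite subrr mulr0 maxxx.
Qed.

End TopK.

Section Subgradient.
Context {R : realType}.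

Definition convexf (psi : R -> R) := forall t x y : R, 0 <= t <= 1 ->
  psi (t * x + (1 - t) * y) <= t * psi x + (1 - t) * psi y.

Definition subgradient (psi sg : R -> R) :=
  forall x y, psi x + sg x * (y - x) <= psi y.

Lemma convexf_slopes psi (x y z : R) : convexf psi -> x < y -> y < z ->
  (psi y - psi x) / (y - x) <= (psi z - psi y) / (z - y).
Proof.
move=> cpsi xy yz; have zx : 0 < z - x by lra.
have := cpsi ((z - y) / (z - x)) x z.
have -> : (z - y) / (z - x) * x + (1 - (z - y) / (z - x)) * z = y.
  by field; rewrite gt_eqF.
have h : 0 <= (z - y) / (z - x) <= 1.
  by rewrite divr_ge0 ?ler_pdivrMr//; lra.
move=> /(_ h); rewrite -(ler_pM2r zx).
have -> : ((z - y) / (z - x) * psi x + (1 - (z - y) / (z - x)) * psi z) * (z - x) =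
  (z - y) * psi x + (y - x) * psi z by field; rewrite gt_eqF.
rewrite ler_pdivrMr ?subr_gt0// mulrAC ler_pdivlMr ?subr_gt0//.
lra.
Qed.

Lemma convexf_subgradient psi : convexf psi -> exists sg, subgradient psi sg.
Proof.
move=> cpsi.
suff H x : exists s, forall y, psi x + s * (y - x) <= psi y.
  by exists (fun x => projT1 (cid (H x))) => x y; case: cid.
(* The slopes to the left of [x] are bounded by every slope to the right, so their supremum is a
   subgradient. *)
pose S := [set (psi x - psi y) / (x - y) | y in [set y | y < x]].
have Sub z : x < z -> ubound S ((psi z - psi x) / (z - x)).
  by move=> xz _ [y /= yx <-]; exact: convexf_slopes.
have Ssup : has_sup S.
  split; first by exists ((psi x - psi (x - 1)) / (x - (x - 1))), (x - 1) => //=; lra.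
  by exists ((psi (x + 1) - psi x) / (x + 1 - x)); apply: Sub; lra.
exists (sup S) => y; have [yx|xy|->] := ltgtP y x; last by rewrite subrr mulr0 addr0.
- have : (psi x - psi y) / (x - y) <= sup S.
    by apply: ub_le_sup; [case: Ssup|exists y].
  by rewrite ler_pdivrMr ?subr_gt0//; lra.
- have : sup S <= (psi y - psi x) / (y - x).
    by apply: ge_sup; [case: Ssup|exact: Sub].
  by rewrite ler_pdivlMr ?subr_gt0//; lra.
Qed.

(* The weights of the [k] largest values of a convex function, times its slopes,
   are monotone; equal arguments carry equal weights and equal slopes. *)
Lemma weighted_slopes_mono psi sg om (a b : R) : subgradient psi sg ->
  {homo om : a b / a <= b} -> (forall a, 0 <= om a) -> a <= b ->
  om (psi a) * sg a <= om (psi b) * sg b.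
Proof.
move=> Hs hom om0; rewrite le_eqVlt => /orP[/eqP->//|ab].
have hab := Hs a b; have hba := Hs b a.
have sab : sg a <= sg b.
  have : sg a * (b - a) <= sg b * (b - a) by lra.
  by rewrite ler_pM2r// subr_gt0.
have [pp|pp] := leP (psi a) (psi b).
  have sb : 0 <= sg b.
    have : 0 <= sg b * (b - a) by lra.
    by rewrite pmulr_lge0 ?subr_gt0.
  apply: (@le_trans _ _ (om (psi a) * sg b)); first by rewrite ler_wpM2l.
  by rewrite ler_wpM2r// hom.
have sa : sg a <= 0.
  have : sg a * (b - a) <= 0 by lra.
  by rewrite pmulr_lle0 ?subr_gt0.
apply: (@le_trans _ _ (om (psi b) * sg a)); last by rewrite ler_wpM2l.
by rewrite ler_wnM2r// hom// ltW.
Qed.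

End Subgradient.

(** * Integration of tangent inequalities *)

Section Majorization.
Context {R : realType}.

Lemma abel_summation (s e : nat -> R) n : \sum_(j < n.+1) s j * e j =
  s n * (\sum_(j < n.+1) e j) +
  \sum_(m < n) (s m - s m.+1) * (\sum_(j < m.+1) e j).
Proof.
elim: n => [|n IH]; first by rewrite big_ord0 !big_ord1 addr0.
rewrite big_ord_recr IH /= [in RHS]big_ord_recr [X in _ = _ + X]big_ord_recr /=.
move: (\sum_(i < n.+1) e i) (\sum_(i < n) _) => A B; ring.
Qed.

Lemma topk_map_srt k (psi : R -> R) (y : seq R) (n : nat) : size y = n ->
  topk k (map psi y) = topk k [seq psi (srt y (nat_of_ord s)) | s <- enum 'I_n].
Proof.
move=> yn; apply: topk_perm.
have -> : [seq psi (srt y (nat_of_ord s)) | s <- enum 'I_n] = map psi (mkseq (srt y) n).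
  by rewrite /mkseq -val_enum_ord -!map_comp.
apply: perm_map; rewrite -yn -(size_sort (fun a b => b <= a) y) mkseq_nth.
by rewrite perm_sym perm_sort.
Qed.

(** The weights optimal for [ya] are transported by rank to [yx], where they are merely admissible;
    the tangents of [psi] at the entries of [ya] do the rest. *)
Lemma topk_tangent k n (psi sg om : R -> R) (ya yx : seq R) :
  (1 <= k <= n)%N -> size ya = n -> size yx = n -> subgradient psi sg ->
  (forall a, 0 <= om a <= 1) ->
  \sum_(b <- map psi ya) om b = k%:R ->
  \sum_(b <- map psi ya) om b * b = topk k (map psi ya) ->
  topk k (map psi ya) +
    \sum_(j < n) om (psi (srt ya j)) * sg (srt ya j) * (srt yx j - srt ya j)
  <= topk k (map psi yx).
Proof.
move=> kn an xn Hsg om01 omk omE.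
rewrite [leRHS](topk_map_srt k psi xn).
apply: le_trans (@topk_ge _ 'I_n k (fun s => psi (srt yx (nat_of_ord s)))
  (fun s => om (psi (srt ya (nat_of_ord s)))) _ _ _); last 3 first.
- by rewrite card_ord.
- by move=> s; exact: om01.
- by rewrite -omk big_map (sum_srt _ (fun a => om (psi a))) an.
rewrite -omE big_map (sum_srt _ (fun a => om (psi a) * psi a)) an -big_split /=.
apply: ler_sum => j _; rewrite -mulrA -mulrDr.
by apply: ler_wpM2l; [case/andP: (om01 (psi (srt ya j)))|exact: Hsg].
Qed.

Lemma exp_jensen n (v q : 'I_n -> R) : (forall j, 0 <= v j) -> \sum_j v j = 1 ->
  expR (\sum_j v j * q j) <= \sum_j v j * expR (q j).
Proof.
move=> v0 v1; set Q := \sum_j v j * q j.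
have -> : expR Q = \sum_j v j * (expR Q * (1 + (q j - Q))).
  transitivity (expR Q * (\sum_j v j + (\sum_j v j * q j - (\sum_j v j) * Q))).
    by rewrite v1 -/Q mul1r subrr addr0 mulr1.
  rewrite mulr_suml -sumrB -big_split mulr_sumr; apply: eq_bigr => j _ /=; ring.
apply: ler_sum => j _; rewrite ler_wpM2l//.
have -> : expR (q j) = expR Q * expR (q j - Q) by rewrite -expRD addrC subrK.
by apply: ler_wpM2l; [exact: expR_ge0|exact: expR_ge1Dx].
Qed.

(** The shares [v j] of the optimal sum [T] form a probability vector, and Jensen's inequality for
    [expR] turns the tangents of [ln (psi x)] into a tangent for the logarithm of a sum of
    exponentials. *)
Lemma ln_topk_tangent k n (psi sg om : R -> R) (ya yx : seq R) :
  (1 <= k <= n)%N -> size ya = n -> size yx = n -> (forall x, 0 < psi x) ->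
  subgradient (fun x => ln (psi x)) sg -> (forall a, 0 <= om a <= 1) ->
  \sum_(b <- map psi ya) om b = k%:R ->
  \sum_(b <- map psi ya) om b * b = topk k (map psi ya) ->
  let T := topk k (map psi ya) in
  0 < T -> ln T +
    \sum_(j < n) (om (psi (srt ya j)) * (psi (srt ya j) * sg (srt ya j))) / T
      * (srt yx j - srt ya j)
  <= ln (topk k (map psi yx)).
Proof.
move=> kn an xn psi0 Hsg om01 omk omE T T0.
pose v (j : 'I_n) := om (psi (srt ya j)) * psi (srt ya j) / T.
have v0 j : 0 <= v j.
  apply: divr_ge0 (ltW T0); apply: mulr_ge0 (ltW (psi0 _)).
  by case/andP: (om01 (psi (srt ya j))).
have v1 : \sum_j v j = 1.
  rewrite -mulr_suml -an -(sum_srt ya (fun a => om (psi a) * psi a)).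
  by rewrite -(big_map psi xpredT (fun b => om b * b)) omE divff// gt_eqF.
pose q (j : 'I_n) := sg (srt ya j) * (srt yx j - srt ya j).
have key : T * expR (\sum_j v j * q j) <= topk k (map psi yx).
  rewrite [leRHS](topk_map_srt k psi xn).
  apply: le_trans (@topk_ge _ 'I_n k (fun s => psi (srt yx (nat_of_ord s)))
    (fun s => om (psi (srt ya (nat_of_ord s)))) _ _ _); last 3 first.
  - by rewrite card_ord.
  - by move=> s; exact: om01.
  - by rewrite -omk big_map (sum_srt _ (fun a => om (psi a))) an.
  apply: (@le_trans _ _ (T * \sum_j v j * expR (q j))).
    by rewrite ler_pM2l//; exact: exp_jensen.
  rewrite mulr_sumr; apply: ler_sum => j _.
  have -> : T * (v j * expR (q j)) = om (psi (srt ya j)) * (psi (srt ya j) * expR (q j)).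
    by rewrite /v; field; rewrite gt_eqF.
  apply: ler_wpM2l; first by case/andP: (om01 (psi (srt ya j))).
  rewrite -[psi (srt ya j)]lnK ?posrE// -expRD -[leRHS]lnK ?posrE// ler_expR.
  exact: Hsg.
have -> : \sum_(j < n) (om (psi (srt ya j)) * (psi (srt ya j) * sg (srt ya j))) / T
      * (srt yx j - srt ya j) = \sum_j v j * q j.
  by apply: eq_bigr => j _; rewrite /v /q; ring.
rewrite -[X in _ + X]expRK -lnM ?posrE ?expR_gt0//.
rewrite ler_ln ?posrE//; first by rewrite mulr_gt0 ?expR_gt0.
by apply: lt_le_trans key; rewrite mulr_gt0 ?expR_gt0.
Qed.

(** The slopes [s] decrease with the rank, so Abel summation leaves nonnegative coefficients on the
    partial sums; the full sum drops out because the totals agree. The parameter [ka] tends to 0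
    only after the integration. *)
Lemma majorization_integral n (al : nat -> R) (xi : R -> nat -> R) (E T : R)
    (s : nat -> R) (h : R -> R) : 0 <= E ->
  (forall m ka, (m < n)%N -> 0 < ka -> exists2 w,
     strip_subharmonic w ((\sum_(j < m.+1) al j) / (1 + ka)) &
     forall t, w 1 t <= \sum_(j < m.+1) xi t j + ka * E) ->
  (forall t, \sum_(j < n.+1) xi t j = \sum_(j < n.+1) al j) ->
  (forall j, (j < n)%N -> s j.+1 <= s j) ->
  (forall t, T + \sum_(j < n.+1) s j * (xi t j - al j) <= h t) ->
  (T%:E <= \int[lebesgue_measure]_t (h t * beta0 t)%:E)%E.
Proof.
move=> E0 Hw Hn Hs Hh.
pose A m := \sum_(j < m.+1) al j.
pose de (m : 'I_n) := s m - s m.+1.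
have de0 m : 0 <= de m by rewrite subr_ge0 Hs.
(* [ka * K] bounds the total loss: [E] accounts for the boundary values, [|A m|] for the passage
   from [A m] to [A m / (1 + ka)]. *)
pose K := \sum_(m < n) de m * (E + `|A m|).
have K0 : 0 <= K by apply: sumr_ge0 => m _; rewrite mulr_ge0// addr_ge0.
have key ka : 0 < ka -> ((T - ka * K)%:E <= \int[lebesgue_measure]_t (h t * beta0 t)%:E)%E.
  move=> ka0.
  have /choice [w wP] (m : 'I_n) : exists w, strip_subharmonic w (A m / (1 + ka)) /\
      forall t, w 1 t <= \sum_(j < m.+1) xi t j + ka * E.
    by have [w w1 w2] := Hw m ka (ltn_ord m) ka0; exists w.
  have SW := strip_subharmonic_sum de0 (fun m => (wP m).1).
  have := strip_subharmonic_le (k := T - \sum_m de m * (ka * E + A m)) (h := h) SW.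
  move=> H; apply: le_trans (H _).
    rewrite lee_fin -addrA lerD2l /K mulr_sumr -!sumrN -big_split /=.
    apply: ler_sum => m _.
    have -> : - (de m * (ka * E + A m)) + de m * (A m / (1 + ka)) =
      de m * (A m / (1 + ka) - A m - ka * E) by ring.
    have -> : - (ka * (de m * (E + `|A m|))) = de m * (- ka * `|A m| - ka * E) by ring.
    apply: ler_wpM2l => //; rewrite lerD2r.
    have k1 : 0 < 1 + ka by lra.
    have -> : A m / (1 + ka) - A m = - ka * A m / (1 + ka) by field; rewrite gt_eqF.
    rewrite !mulNr lerN2 ler_pdivrMr//.
    have := ler_norm (A m); have := normr_ge0 (A m); nra.
  move=> t; apply: le_trans (Hh t).
  rewrite -addrA lerD2l (abel_summation s (fun j => xi t j - al j)).
  rewrite sumrB Hn subrr mulr0 add0r -sumrN -big_split /=.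
  apply: ler_sum => m _; rewrite sumrB -/(A m) -mulrN -mulrDr ler_wpM2l//.
  by have := (wP m).2 t; lra.
case: (\int[_]_t _)%E key => [v|//|] key.
- rewrite lee_fin; apply/ler_addgt0Pr => e e0.
  have ke0 : 0 < e / (K + 1) by rewrite divr_gt0//; lra.
  have := key _ ke0; rewrite lee_fin.
  have : e / (K + 1) * K <= e.
    by rewrite mulrAC ler_pdivrMr ?ler_pM2l//; lra.
  by lra.
- by rewrite leey.
- by have := key 1 ltr01; rewrite leeNy_eq.
Qed.

End Majorization.

(** * Log-majorization *)

Section MatrixInterpolation.
Context {R : realType} (n d : nat).
Local Notation C := R[i].
Variables (U : 'I_n -> 'M[C]_d) (l : 'I_n -> 'I_d -> R).
Hypothesis U1 : forall i, adjmx (U i) *m U i = 1%:M.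

(* With [l i] the logarithms of the eigenvalues of [C_i] and [z = x + i y], this
   is the product of the powers [C_i ^ z]. *)
Definition powfac i x y : 'M[C]_d :=
  U i *m diag_mx (\row_s cexp ((x +i* y) * (l i s)%:C)) *m adjmx (U i).
Definition powprod x y : 'M[C]_d := \big[mulmx/1%:M]_(i < n) powfac i x y.
Definition logsum : 'M[C]_d := \sum_(i < n) U i *m rdiag (l i) *m adjmx (U i).

(** All factors are the identity at 0, so their derivatives there add up regardless of the order.
    This is how the sum of the logarithms arises from a noncommutative product. *)
Lemma is_esmx_big m (A : 'I_m -> R -> R -> 'M[C]_d) (A1 : 'I_m -> 'M[C]_d) :
  (forall i, is_esmx (A i) 1%:M (A1 i)) ->
  is_esmx (fun x y => \big[mulmx/1%:M]_(i < m) A i x y) 1%:M (\sum_(i < m) A1 i).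
Proof.
elim: m A A1 => [|m IH] A A1 HA i j.
  rewrite big_ord0; apply: is_es_ext (is_esmx_cst 1%:M i j) => x y.
  by rewrite big_ord0.
have := is_esmxM (HA ord0) (IH _ _ (fun i => HA (lift ord0 i))) i j.
rewrite !mulmx1 mul1mx big_ord_recl => H.
by apply: is_es_ext H => x y; rewrite big_ord_recl.
Qed.

Lemma powprod_es : is_esmx powprod 1%:M logsum.
Proof.
apply: is_esmx_big => i.
have := is_esmxM (is_esmxM (is_esmx_cst (U i)) (is_esmx_diag (l i))) (is_esmx_cst (adjmx (U i))).
by rewrite mulmx1 (mulmx1C (U1 i)) mulmx0 addr0 mul0mx add0r.
Qed.

Lemma big_mulmx_unitary m (A : 'I_m -> 'M[C]_d) : (forall i, adjmx (A i) *m A i = 1%:M) ->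
  adjmx (\big[mulmx/1%:M]_(i < m) A i) *m \big[mulmx/1%:M]_(i < m) A i = 1%:M.
Proof.
elim: m A => [|m IH] A HA; first by rewrite big_ord0 adjmx1 mul1mx.
rewrite big_ord_recl adjmxM mulmxA -[adjmx _ *m _ *m A _]mulmxA HA mulmx1.
exact: IH (fun i => HA (lift ord0 i)).
Qed.

Lemma sqr_norm_cexp (z : C) : `|cexp z| ^+ 2 = (expR (2 * complex.Re z))%:C.
Proof.
case: z => a b; rewrite -add_Re2_Im2 /cexp /=; congr (_%:C).
rewrite !mul0r subr0 addr0 !exprMn -mulrDr cos2Dsin2 mulr1.
by rewrite -expRM_natl.
Qed.

Lemma powprod_unitary y : adjmx (powprod 0 y) *m powprod 0 y = 1%:M.
Proof.
apply: big_mulmx_unitary => i.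
rewrite /powfac !adjmxM adjmxK !mulmxA -[_ *m adjmx (U i) *m U i]mulmxA U1 mulmx1.
rewrite -[U i *m _ *m diag_mx _]mulmxA.
suff -> : adjmx (diag_mx (\row_s cexp ((0 +i* y) * (l i s)%:C))) *m
    diag_mx (\row_s cexp ((0 +i* y) * (l i s)%:C)) = 1%:M.
  by rewrite mulmx1 (mulmx1C (U1 i)).
apply/matrixP => s t; rewrite mul_mx_diag !mxE eq_sym.
have [st|] := eqVneq s t; last by rewrite mulr0n conjc0 mul0r.
rewrite ?st mulr1n mulrC -sqr_normc sqr_norm_cexp /= !mul0r mulr0 subr0 mulr0 expR0.
by [].
Qed.

Let h : R := \sum_(i < n) \sum_(s < d) l i s.

Lemma det_powprod x y : \det (powprod x y) = cexp ((x +i* y) * h%:C).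
Proof.
rewrite /powprod (big_morph _ (@det_mulmx _ d) (det1 _ d)).
transitivity (\prod_(i < n) \prod_(s < d) cexp ((x +i* y) * (l i s)%:C)).
  apply: eq_bigr => i _; rewrite !det_mulmx mulrAC -det_mulmx (mulmx1C (U1 i)) det1 mul1r.
  by rewrite det_diag; apply: eq_bigr => s _; rewrite mxE.
rewrite /h rmorph_sum mulr_sumr (big_morph _ (@cexpD R) (@cexp0 R)).
apply: eq_bigr => i _; rewrite rmorph_sum mulr_sumr (big_morph _ (@cexpD R) (@cexp0 R)).
by [].
Qed.

Lemma mxtrace_conj_rdiag (V : 'M[C]_d) (a : 'I_d -> R) : adjmx V *m V = 1%:M ->
  \tr (V *m rdiag a *m adjmx V) = (\sum_s a s)%:C.
Proof.
move=> V1; rewrite -mulmxA mxtrace_mulC -mulmxA V1 mulmx1 mxtrace_diag rmorph_sum.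
by apply: eq_bigr => s _; rewrite mxE.
Qed.

Lemma logsum_adj : adjmx logsum = logsum.
Proof.
have -> : adjmx logsum = \sum_(i < n) adjmx (U i *m rdiag (l i) *m adjmx (U i)).
  apply/matrixP => i j; rewrite adjmxE !summxE rmorph_sum.
  by apply: eq_bigr => s _; rewrite adjmxE.
by apply: eq_bigr => i _; rewrite !adjmxM adjmxK adjmx_rdiag mulmxA.
Qed.

Variables (V : 'M[C]_d) (a : 'I_d -> R).
Hypothesis V1 : adjmx V *m V = 1%:M.
Hypothesis logsumE : logsum = V *m rdiag a *m adjmx V.

Lemma sum_eigen_logsum : \sum_s a s = h.
Proof.
apply: (@complexI R); rewrite -(mxtrace_conj_rdiag a V1) -logsumE /logsum raddf_sum /=.
rewrite /h rmorph_sum; apply: eq_bigr => i _; exact: mxtrace_conj_rdiag.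
Qed.

Variables (mu : R -> 'I_d -> R) (Q : R -> 'M[C]_d).
Hypothesis Q1 : forall t, adjmx (Q t) *m Q t = 1%:M.
Hypothesis sqrE : forall t, adjmx (powprod 1 t) *m powprod 1 t =
  Q t *m rdiag (mu t) *m adjmx (Q t).

(** The determinant does not see noncommutativity, so this product is the same for all [t]. It gives
    the equality of total sums and, through [mu_gt0], finite logarithms. *)
Lemma prod_mu t : \prod_s mu t s = expR (2 * h).
Proof.
apply: (@complexI R); have := congr1 determinant (sqrE t).
rewrite det_mulmx det_adjmx mulrC -sqr_normc det_powprod sqr_norm_cexp /=.
rewrite !det_mulmx mulrAC -det_mulmx (mulmx1C (Q1 t)) det1 mul1r det_diag rmorph_prod.
rewrite mul1r mulr0 subr0 => ->.
by apply: eq_bigr => s _; rewrite mxE.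
Qed.

Lemma mu_ge0 t s : 0 <= mu t s.
Proof.
have E : rdiag (mu t) = adjmx (powprod 1 t *m Q t) *m (powprod 1 t *m Q t).
  rewrite adjmxM mulmxA -[adjmx (Q t) *m _ *m _]mulmxA sqrE !mulmxA Q1 mul1mx.
  by rewrite -mulmxA Q1 mulmx1.
have := congr1 (fun M : 'M[C]_d => M s s) E; rewrite /rdiag !mxE eqxx mulr1n => E'.
rewrite -lecR E'; apply: sumr_ge0 => i _.
by rewrite adjmxE mulrC -sqr_normc exprn_ge0.
Qed.

Lemma mu_gt0 t s : 0 < mu t s.
Proof.
rewrite lt_def mu_ge0 andbT; apply/negP => /eqP m0.
have := expR_gt0 (2 * h); rewrite -(prod_mu t) (bigD1 s)//= m0 mul0r ltxx.
by [].
Qed.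

Let ya : seq R := [seq a s | s <- enum 'I_d].
Let yx t : seq R := [seq ln (mu t s) / 2 | s <- enum 'I_d].

Lemma sum_ln_mu t : \sum_s ln (mu t s) = 2 * h.
Proof.
apply: expR_inj; rewrite -(prod_mu t) expR_sum.
by apply: eq_bigr => s _; rewrite lnK// posrE mu_gt0.
Qed.

(** The [m.+1] largest entries sum to at least the fraction [m.+1 / d] of the total, which is [h]
    for every [t]. Being uniform in [t], this bound controls the regularization error in
    [logmajorization]. *)
Lemma topk_yx_ge m t : (m.+1 <= d)%N -> - `|h| <= topk m.+1 (yx t).
Proof.
move=> md; have d0 : 0 < d%:R :> R by rewrite ltr0n (leq_trans _ md).
have q1 : m.+1%:R / d%:R <= 1 :> R by rewrite ler_pdivrMr// mul1r ler_nat.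
have q0 : 0 <= m.+1%:R / d%:R :> R by rewrite divr_ge0.
apply: le_trans (@topk_ge _ 'I_d m.+1 _ (fun _ => m.+1%:R / d%:R) _ _ _); last 3 first.
- by rewrite card_ord.
- by move=> _; rewrite q0.
- by rewrite sumr_const card_ord -[LHS]mulr_natr divfK// gt_eqF.
rewrite -mulr_sumr -mulr_suml sum_ln_mu.
have -> : 2 * h / 2 = h by field.
have := ler_norm (- h); rewrite normrN => hh.
have := ler_wpM2l q0 hh; have : m.+1%:R / d%:R * `|h| <= `|h| by rewrite ler_piMl.
by lra.
Qed.

(** The indicator of the image of [f] is an admissible weight in [topk_ge]. *)
Lemma prod_mu_inj_le m t (f : 'I_m.+1 -> 'I_d) : injective f -> (m.+1 <= d)%N ->
  \prod_i mu t (f i) <= expR (2 * topk m.+1 (yx t)).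
Proof.
move=> finj md.
have -> : \prod_i mu t (f i) = expR (2 * \sum_i ln (mu t (f i)) / 2).
  rewrite mulr_sumr expR_sum; apply: eq_bigr => i _.
  by rewrite mulrC divfK// lnK// posrE mu_gt0.
rewrite ler_expR ler_pM2l//.
pose w (s : 'I_d) : R := (s \in codom f)%:R.
have sumw (F : 'I_d -> R) : \sum_s w s * F s = \sum_i F (f i).
  transitivity (\sum_(s <- codom f) F s); last by rewrite big_image.
  have fU : uniq (codom f) by rewrite map_inj_uniq ?enum_uniq.
  rewrite (big_uniq _ fU) /= [RHS]big_mkcond.
  by apply: eq_bigr => s _; rewrite /w; case: (_ \in _); rewrite ?mul1r ?mul0r.
apply: le_trans (@topk_ge _ 'I_d m.+1 _ w _ _ _).
- by rewrite (sumw (fun s => ln (mu t s) / 2)).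
- by rewrite card_ord.
- by move=> s; rewrite /w; case: (_ \in _); rewrite ?lexx ?ler01.
- under eq_bigr do rewrite -[w _]mulr1.
  by rewrite (sumw (fun=> 1)) sumr_const card_ord.
Qed.

Lemma sorting_indices m : (m.+1 <= d)%N -> exists2 p : 'I_m.+1 -> 'I_d,
  injective p & forall j, a (p j) = srt ya j.
Proof.
move=> md; pose e := sort (fun i j => a j <= a i) (enum 'I_d).
have se : size e = d by rewrite size_sort size_enum_ord.
have x0 : 'I_d by exact: Ordinal (leq_trans (ltn0Sn m) md).
have je (j : 'I_m.+1) : (j < size e)%N by rewrite se (leq_trans (ltn_ord j)).
exists (fun j : 'I_m.+1 => nth x0 e j).
  move=> i j /eqP; rewrite nth_uniq ?sort_uniq ?enum_uniq// => /eqP; exact: val_inj.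
move=> j; rewrite /srt /ya sort_map (nth_map x0)//.
Qed.

Lemma logmajorization m ka : (m.+1 <= d)%N -> 0 < ka -> exists2 w,
  strip_subharmonic w ((\sum_(j < m.+1) srt ya j) / (1 + ka)) &
  forall t, w 1 t <= topk m.+1 (yx t) + ka * expR (2 * `|h|).
Proof.
move=> md ka0; have [p pinj pa] := sorting_indices md.
pose W := colsub p V.
have W1 : adjmx W *m W = 1%:M.
  apply/matrixP => i j; have := congr1 (fun M : 'M[C]_d => M (p i) (p j)) V1.
  rewrite !mxE (inj_eq pinj) => <-.
  by apply: eq_bigr => s _; rewrite !mxE.
have trE : \tr (adjmx W *m logsum *m W) = (\sum_(j < m.+1) srt ya j)%:C.
  have VE : adjmx V *m logsum *m V = rdiag a.
    by rewrite logsumE !mulmxA V1 mul1mx -mulmxA V1 mulmx1.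
  rewrite rmorph_sum; apply: eq_bigr => j _; rewrite -pa.
  transitivity (rdiag a (p j) (p j)); last by rewrite !mxE eqxx mulr1n.
  rewrite -VE.
  rewrite !mxE; apply: eq_bigr => s _; rewrite !mxE; congr (_ * _).
  by apply: eq_bigr => s' _; rewrite !mxE.
have := is_esmxM (is_esmxM (is_esmx_cst (adjmx W)) powprod_es) (is_esmx_cst W).
rewrite mulmx1 W1 mulmx0 addr0 mul0mx add0r => /is_es_det [s [sE s0 s1]].
have es00 : es s 0 0 = 1.
  rewrite -s0 /es; apply: eq_bigr => q _.
  by rewrite (_ : 0 +i* 0 = 0 :> C)// mul0r cexp0 mulr1.
have es10 : es (es_deriv s) 0 0 = (\sum_(j < m.+1) srt ya j)%:C.
  rewrite -trE -s1 /es big_map; apply: eq_bigr => q _ /=.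
  rewrite (_ : 0 +i* 0 = 0 :> C)// mul0r cexp0 mulr1.
  by case: q => [[u v] al] /=; apply/eqP; rewrite eq_complex /= !mul0r subr0 addr0 !eqxx.
have sqE x y : (esR s x y ^+ 2 + esI s x y ^+ 2)%:C =
    `|\det (adjmx W *m powprod x y *m W)| ^+ 2.
  by rewrite sE -Re_es -Im_es add_Re2_Im2.
have := @es_strip_subharmonic _ s ka ka0.
rewrite -!Re_es -Im_es es00 es10 /= => H.
eexists; first apply: H => //.
  move=> y; rewrite -lecR sqE.
  (* On the imaginary axis [powprod] is unitary: all squared singular values are 1, and so is the
     bound. *)
  apply: (@det_compression_le _ _ _ W (powprod 0 y) 1%:M (fun=> 1) 1) => //.
  - by rewrite adjmx1 mulmx1.
  - rewrite powprod_unitary adjmx1 mulmx1 mul1mx.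
    by apply/matrixP => i j; rewrite !mxE.
  - by move=> f _; rewrite big1.
move=> t /=; set X := topk _ _.
have Nle : esR s 1 t * esR s 1 t + esI s 1 t * esI s 1 t <= expR (2 * X).
  rewrite -!expr2 -lecR sqE.
  apply: (@det_compression_le _ _ _ W (powprod 1 t) (Q t) (mu t)) => //.
  - exact: mu_ge0.
  - by move=> f finj; exact: prod_mu_inj_le.
have Nge : 0 <= esR s 1 t * esR s 1 t + esI s 1 t * esI s 1 t.
  by rewrite -!expr2 addr_ge0 ?sqr_ge0.
have l1 : 0 <= ln (1 + ka) by rewrite ln_ge0// lerDl ltW.
have l2 : ln (esR s 1 t * esR s 1 t + esI s 1 t * esI s 1 t + ka) <= ln (expR (2 * X) + ka).
  rewrite ler_ln ?posrE ?lerD2r//; first by rewrite ltr_wpDl.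
  by rewrite addr_gt0 ?expR_gt0.
(* This is [ln (1 + u) <= u] for [u = ka * expR (- (2 * X))]; the lower bound on [X] then frees the
   error from [t]. *)
have l3 : ln (expR (2 * X) + ka) <= 2 * X + ka * expR (- (2 * X)).
  rewrite -[leRHS]expRK ler_ln ?posrE ?addr_gt0 ?expR_gt0//.
  rewrite expRD; apply: (@le_trans _ _ (expR (2 * X) * (1 + ka * expR (- (2 * X))))).
    by rewrite mulrDr mulr1 mulrCA -expRD subrr expR0 mulr1.
  by rewrite ler_wpM2l ?expR_ge0// expR_ge1Dx.
have l4 : ka * expR (- (2 * X)) <= ka * expR (2 * `|h|).
  by rewrite ler_pM2l// ler_expR; have := topk_yx_ge t md; rewrite -/X; lra.
have l5 : 0 <= ka * expR (2 * `|h|) by rewrite mulr_ge0 ?expR_ge0// ltW.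
lra.
Qed.

End MatrixInterpolation.

(** * Transfer to tensors *)

Section TensorTopK.
Context {R : realType} {N : nat} {I : 'I_N -> nat}.
Local Notation C := R[i].
Local Notation d := #|mindex I|.

Lemma positive_herm_decomp (X : tensor R I) : positive_herm X ->
  let dec := full_decomp X in
  [/\ tmx X = vmx dec.2 *m rdiag dec.1 *m adjmx (vmx dec.2),
      adjmx (vmx dec.2) *m vmx dec.2 = 1%:M & forall s, 0 < dec.1 s].
Proof.
move=> [Xh Xpos] dec; have Xd := hermitian_full_decomp Xh.
have /herm_decompP [E1 E2] := Xd; split => // s; apply: Xpos.
by exists d, dec.1, dec.2; split => //; exists s.
Qed.

Lemma herm_rank_le (X : tensor R I) r : positive_herm X -> herm_rank X r -> (r <= d)%N.
Proof.
move=> [Xh _] [_]; apply.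
by exists (full_decomp X).1, (full_decomp X).2; exact: hermitian_full_decomp.
Qed.

Lemma tmx_tprod n (A : 'I_n -> tensor R I) :
  tmx (tprod A) = \big[mulmx/1%:M]_(i < n) tmx (A i).
Proof. by rewrite /tprod (big_morph _ (@tmxM R N I) (@tmx1 R N I)). Qed.

(* The singular values of the interpolating product [C_1^z ... C_n^z] at
   [z = 1 + i t] are the exponentials of [x t], and [a] lists the eigenvalues
   of [\sum_i log C_i]. *)
Lemma tensor_logmajorization n (C : 'I_n -> tensor R I) :
  (forall i, positive_herm (C i)) ->
  exists (a : 'I_d -> R) (x : R -> 'I_d -> R),
  [/\ (forall k (f : R -> R), (forall y, 0 <= f (expR y)) ->
        kyfan k (tfunr f (texp (\sum_(i < n) tlog (C i)))) =
        topk k [seq f (expR b) | b <- [seq a s | s <- enum 'I_d]]),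
      (forall k (f : R -> R) t, (forall y, 0 <= f (expR y)) ->
        kyfan k (tfunr f (tabs (tprod (fun i => tpow (C i) (1 +i* t))))) =
        topk k [seq f (expR b) | b <- [seq x t s | s <- enum 'I_d]]),
      (forall t, \sum_s x t s = \sum_s a s) &
      exists2 E : R, 0 <= E & forall m ka, (m < d)%N -> 0 < ka -> exists2 w,
        strip_subharmonic w
          ((\sum_(j < m.+1) srt [seq a s | s <- enum 'I_d] j) / (1 + ka)) &
        forall t, w 1 t <= \sum_(j < m.+1) srt [seq x t s | s <- enum 'I_d] j + ka * E].
Proof.
move=> Cpos.
pose dec i := full_decomp (C i).
(* [tlog] and [tpow] rest on the same chosen decomposition of [C i], so [U] and [l] describe both
   the sum of the logarithms and the product of the powers. *)
pose U i := vmx (dec i).2; pose l i s := ln ((dec i).1 s).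
have U1 i : adjmx (U i) *m U i = 1%:M by have [] := positive_herm_decomp (Cpos i).
pose H := \sum_(i < n) tlog (C i).
have HE : tmx H = logsum U l.
  by rewrite tmx_sum; apply: eq_bigr => i _; exact: tmx_tfunr.
have [|V [a [V1 logsumE]]] := @hermitian_spectral _ _ (logsum U l).
  exact: logsum_adj.
pose Gt t := tprod (fun i => tpow (C i) (1 +i* t)).
have GE t : tmx (Gt t) = powprod U l 1 t.
  rewrite tmx_tprod; apply: eq_bigr => i _; exact: tmx_outer.
pose Z t := tmul (tadj (Gt t)) (Gt t).
have ZE t : tmx (Z t) = adjmx (powprod U l 1 t) *m powprod U l 1 t.
  by rewrite tmxM tmx_adj GE.
have Zh t : Defs.hermitian (Z t).
  by apply: tmx_inj; rewrite tmx_adj ZE adjmxM adjmxK.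
pose mu t s := (full_decomp (Z t)).1 s; pose Q t := vmx (full_decomp (Z t)).2.
have ZQ t : tmx (Z t) = Q t *m rdiag (mu t) *m adjmx (Q t) /\ adjmx (Q t) *m Q t = 1%:M.
  exact: (proj1 (herm_decompP _ _ _) (hermitian_full_decomp (Zh t))).
have Q1 t : adjmx (Q t) *m Q t = 1%:M by case: (ZQ t).
have sqrE t : adjmx (powprod U l 1 t) *m powprod U l 1 t =
    Q t *m rdiag (mu t) *m adjmx (Q t) by rewrite -ZE; case: (ZQ t).
have mu0 t s : 0 < mu t s := mu_gt0 U1 Q1 sqrE t s.
exists a, (fun t s => ln (mu t s) / 2); split.
- move=> k f f0.
  have Hdec := full_decomp_of (etrans HE logsumE) V1.
  have /herm_decompP [E1 E2] := Hdec.
  have permH := full_decomp_perm (etrans HE logsumE) V1.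
  rewrite (kyfan_tfunr_tmx k (tmx_tfunr (@expR R) H) E2)//.
  apply: topk_perm; rewrite (map_comp (fun b => f (expR b)) (full_decomp H).1).
  exact: perm_map.
- move=> k f t f0.
  have fs s : f (Num.sqrt (mu t s)) = f (expR (ln (mu t s) / 2)).
    congr f; apply/eqP; rewrite -(eqrXn2 (n := 2))// ?sqrtr_ge0 ?expR_ge0//.
    rewrite sqr_sqrtr ?(ltW (mu0 _ _))// -expRM_natl mulrC divfK// lnK// posrE.
    exact: mu0.
  rewrite (kyfan_tfunr_tmx k (tmx_tfunr (@Num.sqrt R) (Z t)) (Q1 t)).
    by rewrite -map_comp; congr topk; apply: eq_map => s; exact: fs.
  by move=> s; rewrite fs.
- move=> t; rewrite (sum_eigen_logsum U1 V1 logsumE) -mulr_suml (sum_ln_mu U1 Q1 sqrE).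
  by rewrite mulrC mulKf.
- eexists; last first.
    move=> m ka md ka0.
    exact: (logmajorization U1 V1 logsumE Q1 sqrE md ka0).
  exact: expR_ge0.
Qed.

End TensorTopK.

(** * Log-convex functions and the two norm inequalities *)

Section LogConvex.
Context {R : realType}.

Lemma convexf_of_convex_function (g : R^o -> R^o) :
  convex_function [set: R^o] g -> convexf g.
Proof.
move=> cg t x y t01.
have := cg (Itv01 (proj1 (andP t01)) (proj2 (andP t01))) x y.
by apply; rewrite in_setT.
Qed.

(** Log-convexity enters through tangents of [ln (psi x)], while [weighted_slopes_mono] asks for
    tangents of [psi]; [1 + u <= expR u] converts them. *)
Lemma subgradient_exp (psi sg : R -> R) : (forall x, 0 < psi x) ->
  subgradient (fun x => ln (psi x)) sg -> subgradient psi (fun x => psi x * sg x).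
Proof.
move=> psi0 H x y.
have -> : psi y = psi x * expR (ln (psi y) - ln (psi x)).
  by rewrite expRD expRN !lnK ?posrE// mulrCA divff ?mulr1// gt_eqF.
have -> : psi x + psi x * sg x * (y - x) = psi x * (1 + sg x * (y - x)) by ring.
rewrite ler_pM2l//; apply: le_trans (expR_ge1Dx _); rewrite lerD2l.
by have := H x y; lra.
Qed.

(** A zero at [x] spreads to every [y]: as [y] is the midpoint of [x] and [2 * y - x], the value
    [-oo] at one end forces [-oo] at [y]. Unless [psi] vanishes identically, its logarithm is
    therefore finite. *)
Lemma econvex_ln_zero_or_pos (psi : R -> R) : (forall x, 0 <= psi x) ->
  econvex (fun x => lne (psi x)%:E) ->
  (forall x, psi x = 0) \/ (forall x, 0 < psi x).
Proof.
move=> psi0 cpsi; have [[x px]|nz] := pselect (exists x, psi x = 0); last first.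
  by right => x; rewrite lt_def psi0 andbT; apply/eqP => px; apply: nz; exists x.
left => y; have := cpsi (2^-1) x (2 * y - x).
have -> : 2^-1 * x + (1 - 2^-1) * (2 * y - x) = y by field.
have h : 0 <= (2^-1 : R) <= 1 by apply/andP; split; lra.
move=> /(_ h); rewrite px [lne 0%:E]le0_lneNy// gt0_muleNy ?lte_fin ?invr_gt0// addNye leeNy_eq.
have := psi0 y; rewrite le_eqVlt => /orP[/eqP<-//|py].
by rewrite lne_EFin.
Qed.

Lemma econvex_ln (psi : R -> R) : (forall x, 0 < psi x) ->
  econvex (fun x => lne (psi x)%:E) -> convexf (fun x => ln (psi x)).
Proof.
by move=> psi0 cpsi t x y t01; have := cpsi t x y t01; rewrite !lne_EFin.
Qed.

Lemma topk_gt0 k (y : seq R) : (1 <= k <= size y)%N -> (forall b, b \in y -> 0 < b) ->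
  0 < topk k y.
Proof.
move=> /andP[k1 ky] y0; rewrite /topk.
have z0 (j : 'I_k) : 0 < (sort (fun a b => b <= a) y)`_j.
  apply: y0; rewrite -(mem_sort (fun a b => b <= a)); apply: mem_nth.
  by rewrite size_sort (leq_trans (ltn_ord j)).
rewrite (bigD1 (Ordinal k1))//=; apply: ltr_pwDl; first exact: (z0 (Ordinal k1)).
by apply: sumr_ge0 => j _; exact/ltW/z0.
Qed.

Lemma topk_zero k (y : seq R) : (forall b, b \in y -> b = 0) -> topk k y = 0.
Proof.
move=> y0; rewrite /topk big1// => j _.
have [jy|jy] := ltnP j (size y); last by rewrite nth_default ?size_sort.
by apply: y0; rewrite -(mem_sort (fun a b => b <= a)) mem_nth ?size_sort.
Qed.

End LogConvex.

Theorem theorem1p2 (R : realType) (N : nat) (I : 'I_N -> nat) (n r k : nat)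
    (C : 'I_n -> tensor R I)
    (n_ge1 : (1 <= n)%N)
    (C_pos : forall i, positive_herm (C i))
    (C_rank : forall i, herm_rank (C i) r)
    (k_range : (1 <= k <= r)%N) :
  (forall f : R -> R,
    (forall x, 0 < x -> 0 <= f x) ->
    {within `]0, +oo[, continuous f} ->
    econvex (fun x => lne (f (expR x))%:E) ->
    ((kyfan k (tfunr f (texp (\sum_(i < n) tlog (C i)))))%:E <=
     expeR (\int[lebesgue_measure]_(t in [set: R])
       (lne (kyfan k (tfunr f (tabs (tprod (fun i => tpow (C i) (1 +i* t))))))%:E
        * (beta0 t)%:E)))%E) /\
  (forall g : R -> R,
    (forall x, 0 < x -> 0 <= g x) ->
    {within `]0, +oo[, continuous g} ->
    convex_function [set: R^o] (fun x : R^o => g (expR x)) ->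
    ((kyfan k (tfunr g (texp (\sum_(i < n) tlog (C i)))))%:E <=
     \int[lebesgue_measure]_(t in [set: R])
       (kyfan k (tfunr g (tabs (tprod (fun i => tpow (C i) (1 +i* t)))))
        * beta0 t)%:E)%E).
Proof.
have rd : (r <= #|mindex I|)%N := herm_rank_le (C_pos (Ordinal n_ge1)) (C_rank _).
have kd : (1 <= k <= #|mindex I|)%N.
  by case/andP: k_range => -> /leq_trans; exact.
have [a [x [kyA kyX sumX [E E0 HE]]]] := tensor_logmajorization C_pos.
set ya := [seq a s | s <- enum _] in kyA HE.
pose yx t := [seq x t s | s <- enum 'I_#|mindex I|].
(* [majorization_integral] takes the number of entries in the form [n.+1]; there is at least one
   because [1 <= k]. *)
have dE : #|mindex I|.-1.+1 = #|mindex I|.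
  by apply: prednK; case/andP: kd => k1 /(leq_trans k1).
have yaE : size ya = #|mindex I| by rewrite size_map size_enum_ord.
have yxE t : size (yx t) = #|mindex I| by rewrite size_map size_enum_ord.
(* Monotone slopes along the sorted eigenvalues decrease with the rank, so each part only needs a
   monotone slope function and a tangent inequality. *)
have reduce (T : R) (sl : R -> R) (h : R -> R) :
    {homo sl : b c / b <= c} ->
    (forall t, T + \sum_(j < #|mindex I|) sl (srt ya j) * (srt (yx t) j - srt ya j) <= h t) ->
    (T%:E <= \int[lebesgue_measure]_t (h t * beta0 t)%:E)%E.
  move=> slmono Hh.
  apply: (@majorization_integral R #|mindex I|.-1 (srt ya) (fun t => srt (yx t)) E T
    (fun j => sl (srt ya j)) h E0).
  - by move=> m ka md ka0; apply: HE => //; rewrite -dE ltnS ltnW.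
  - have sumE y : size y = #|mindex I| -> \sum_(j < #|mindex I|) srt y j = \sum_(b <- y) b.
      by move=> <-; rewrite (sum_srt y id).
    by move=> t; rewrite dE !sumE// /ya /yx !big_map -!enumT !big_enum; exact: sumX.
  - move=> j jd; apply: slmono; apply: srt_mono => //.
    by rewrite yaE -dE ltnS.
  - by rewrite dE.
have kya (psi : R -> R) : (1 <= k <= size (map psi ya))%N by rewrite size_map yaE.
split=> [f f0 _ fconv|g g0 _ gconv].
- have psi0 b : 0 <= f (expR b) by rewrite f0 ?expR_gt0.
  rewrite kyA//; case: (econvex_ln_zero_or_pos psi0 fconv) => [fz|fp].
    rewrite topk_zero ?expeR_ge0// => c cy; have /mapP [b _ ->] := cy.
    exact: fz.
  have [sg Hsg] := convexf_subgradient (econvex_ln fp fconv).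
  have [om [om_mono om01 omk omE]] := topk_weights (kya (fun b => f (expR b))).
  set T := topk k _ in omE *.
  have T0 : 0 < T.
    by apply: topk_gt0 => // c cy; have /mapP [b _ ->] := cy; exact: fp.
  have Tx0 t : 0 < topk k [seq f (expR b) | b <- yx t].
    apply: topk_gt0; first by rewrite size_map yxE.
    by move=> c cy; have /mapP [b _ ->] := cy; exact: fp.
  (* Both sides are exponentials, so it remains to bound [ln T] by the integral. *)
  rewrite -[T]lnK ?posrE// -[(expR (ln T))%:E]/(expeR (ln T)%:E) lee_expeR.
  under eq_integral do rewrite kyX// lne_EFin ?Tx0// -EFinM.
  (* The slopes are those of the logarithm of the norm: the weighted slopes of [f (expR b)], divided
     by the norm [T]. *)
  apply: (reduce _ (fun b => om (f (expR b)) * (f (expR b) * sg b) / T)).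
    move=> b c bc; rewrite ler_pM2r ?invr_gt0//.
    apply: (weighted_slopes_mono (psi := fun b => f (expR b)) (sg := fun b => f (expR b) * sg b)) => //.
      exact: subgradient_exp.
    by move=> b'; case/andP: (om01 b').
  move=> t; exact: (ln_topk_tangent kd yaE (yxE t) fp Hsg om01 omk omE T0).
- have psi0 b : 0 <= g (expR b) by rewrite g0 ?expR_gt0.
  have [sg Hsg] := convexf_subgradient (convexf_of_convex_function gconv).
  have [om [om_mono om01 omk omE]] := topk_weights (kya (fun b => g (expR b))).
  rewrite kyA//; under eq_integral do rewrite kyX//.
  apply: (reduce _ (fun b => om (g (expR b)) * sg b)).
    move=> b c bc; apply: (weighted_slopes_mono (psi := fun b => g (expR b))) => //.
    by move=> b'; case/andP: (om01 b').
  move=> t; exact: (topk_tangent kd yaE (yxE t) Hsg om01 omk omE).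
Qed.
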